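(* Let $M=(M_n)_{n\in\mathbb{N}}$ be the sequence $$M_n := \frac{1}{(\log\log 3)^{3}}\cdot\bigl(\log\log(n+3)\bigr)^{n+3},\qquad n\in\mathbb{N}.$$ Then there exists a $\mathcal{Q}_M$-subanalytic subset of $\mathbb{R}^2$ of dimension $\le 1$ which is not $\mathcal{Q}_M$-semianalytic. In particular, the classical theorem of Łojasiewicz that every subanalytic set of dimension $\le 1$ is semianalytic is no longer true in quasianalytic structures.
   Context: Here $\mathbb{N}=\{0,1,2,\dots\}$. Denjoy--Carleman class: for an open set $U\subset\mathbb{R}^m$, $\mathcal{Q}_M(U)$ is the set of smooth functions $f:U\to\mathbb{R}$ such that every point of $U$ has a neighbourhood $W\subset U$ and constants $C,R>0$ with $|\partial^{|\alpha|}f/\partial x^\alpha(x)|\le C\,R^{|\alpha|}\,|\alpha|!\,M_{|\alpha|}$ for all $\alpha\in\mathbb{N}^m$, $x\in W$. A set $A\subset\mathbb{R}^m$ is $\mathcal{Q}_M$-semianalytic if each point $a\in\mathbb{R}^m$ has an open neighbourhood $U$ such that $A\cap U$ is a finite union of sets of the form $\{x\in U: f(x)=0,\ g_1(x)>0,\dots,g_k(x)>0\}$ with $f,g_1,\dots,g_k\in\mathcal{Q}_M(U)$. A set $A\subset\mathbb{R}^m$ is $\mathcal{Q}_M$-subanalytic if each point $a\in\mathbb{R}^m$ has a neighbourhood $U$ such that $A\cap U$ is the image under the canonical projection $\mathbb{R}^{m}\times\mathbb{R}^{k}\to\mathbb{R}^m$ (for some $k\in\mathbb{N}$) of a bounded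 $\mathcal{Q}_M$-semianalytic subset of $\mathbb{R}^{m+k}$. *)

(* Defs.v *)
From HB Require Import structures.
From mathcomp Require Import all_boot all_order all_algebra.
From mathcomp Require Import all_classical all_reals all_analysis.
Set Implicit Arguments.
Unset Strict Implicit.
Unset Printing Implicit Defensive.
Import Order.TTheory GRing.Theory Num.Theory.
Import numFieldNormedType.Exports.
Local Open Scope classical_set_scope.
Local Open Scope ring_scope.

(* A function on an open set U of R^m is represented by a total function on
   'rV[R]_m; every notion below depends only on its restriction to U, because
   derivatives at a point of the open set U are determined by values in U. *)

Definition partial (R : realType) (m : nat) (i : 'I_m)
    (f : 'rV[R]_m -> R) : 'rV[R]_m -> R :=
  fun x => 'D_(delta_mx 0 i) f x.

Fixpoint Ck (R : realType) (m k : nat) (U : set 'rV[R]_m)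
    (f : 'rV[R]_m -> R) : Prop :=
  (forall x, U x -> {for x, continuous f}) /\
  match k with
  | 0%N => True
  | k'.+1 => forall i : 'I_m,
      (forall x, U x -> derivable f x (delta_mx 0 i)) /\ Ck k' U (partial i f)
  end.

Definition smooth_on (R : realType) (m : nat) (U : set 'rV[R]_m)
    (f : 'rV[R]_m -> R) : Prop :=
  forall k, Ck k U f.

Definition mdeg (m : nat) (alpha : 'I_m -> nat) : nat := (\sum_(i < m) alpha i)%N.

Definition mpartial (R : realType) (m : nat) (alpha : 'I_m -> nat)
    (f : 'rV[R]_m -> R) : 'rV[R]_m -> R :=
  foldr (fun i g => iter (alpha i) (partial i) g) f (enum 'I_m).

Definition denjoy_carleman (R : realType) (M : nat -> R) (m : nat)
    (U : set 'rV[R]_m) (f : 'rV[R]_m -> R) : Prop :=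
  smooth_on U f /\
  forall a, U a -> exists W : set 'rV[R]_m,
    [/\ nbhs a W, W `<=` U &
      exists C r : R, [/\ 0 < C, 0 < r &
        forall (alpha : 'I_m -> nat) x, W x ->
          `|mpartial alpha f x|
            <= C * r ^+ mdeg alpha * ((mdeg alpha)`!)%:R * M (mdeg alpha)]].

Definition basic_semianalytic (R : realType) (M : nat -> R) (m : nat)
    (U B : set 'rV[R]_m) : Prop :=
  exists (f : 'rV[R]_m -> R) (k : nat) (g : 'I_k -> 'rV[R]_m -> R),
    [/\ denjoy_carleman M U f,
        forall j, denjoy_carleman M U (g j) &
        B = [set x | [/\ U x, f x = 0 & forall j, 0 < g j x]]].

Definition semianalytic (R : realType) (M : nat -> R) (m : nat)
    (A : set 'rV[R]_m) : Prop :=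
  forall a : 'rV[R]_m, exists U : set 'rV[R]_m,
    [/\ open U, U a &
      exists (n : nat) (B : 'I_n -> set 'rV[R]_m),
        (forall j, basic_semianalytic M U (B j)) /\
        A `&` U = \bigcup_j B j].

(* lsubmx : 'rV_(m + k) -> 'rV_m is the canonical projection. *)
Definition subanalytic (R : realType) (M : nat -> R) (m : nat)
    (A : set 'rV[R]_m) : Prop :=
  forall a : 'rV[R]_m, exists U : set 'rV[R]_m,
    nbhs a U /\
    exists (k : nat) (B : set 'rV[R]_(m + k)),
      [/\ bounded_set B, semianalytic M B & A `&` U = lsubmx @` B].

Definition smooth_map_on (R : realType) (m n : nat) (U : set 'rV[R]_m)
    (F : 'rV[R]_m -> 'rV[R]_n) : Prop :=
  forall j : 'I_n, smooth_on U (fun x => F x 0 j).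

(* Embedded C^oo submanifold of dimension p: around each of its points a
   diffeomorphism F : V -> V' between open sets of R^m (with inverse G) maps
   N `&` V onto V' `&` (R^p x {0}). *)
Definition submanifold (R : realType) (m p : nat) (N : set 'rV[R]_m) : Prop :=
  (p <= m)%N /\
  forall a, N a -> exists (V V' : set 'rV[R]_m) (F G : 'rV[R]_m -> 'rV[R]_m),
    [/\ open V, V a & open V'] /\
    [/\ smooth_map_on V F, smooth_map_on V' G,
        forall x, V x -> V' (F x) /\ G (F x) = x,
        forall y, V' y -> V (G y) /\ F (G y) = y &
        forall x, V x -> (N x <-> forall i : 'I_m, (p <= i)%N -> F x 0 i = 0)].

(* The dimension of a subanalytic set is the largest dimension of a nonempty
   submanifold contained in it; the empty set has dimension -oo. *)
Definition dim_le (R : realType) (m : nat) (A : set 'rV[R]_m) (d : nat) : Prop :=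
  forall (p : nat) (N : set 'rV[R]_m),
    N !=set0 -> N `<=` A -> submanifold p N -> (p <= d)%N.

Definition quasianalytic (R : realType) (M : nat -> R) : Prop :=
  forall (m : nat) (U : set 'rV[R]_m) (f : 'rV[R]_m -> R) (a : 'rV[R]_m),
    open U -> connected U -> denjoy_carleman M U f -> U a ->
    (forall alpha, mpartial alpha f a = 0) -> forall x, U x -> f x = 0.

Definition lojasiewicz_property (R : realType) (M : nat -> R) : Prop :=
  forall (m : nat) (A : set 'rV[R]_m),
    subanalytic M A -> dim_le A 1 -> semianalytic M A.

Definition loglog_seq (R : realType) (n : nat) : R :=
  ((ln (ln 3)) ^+ 3)^-1 * (ln (ln (n + 3)%N%:R)) ^+ (n + 3)%N.

(* Main.v *)
Require Import Defs.
From mathcomp Require Import all_boot all_order all_algebra.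
From mathcomp Require Import all_classical all_reals all_analysis.
From mathcomp Require Import ring lra zify.
Set Implicit Arguments.
Unset Strict Implicit.
Unset Printing Implicit Defensive.
Import Order.TTheory GRing.Theory Num.Theory.
Import numFieldNormedType.Exports.
Local Open Scope classical_set_scope.
Local Open Scope ring_scope.

(* Write L n = ln (ln (n + 3)).  The nonsemianalytic set is the projection of
   the curve { (t^2, f t, t) : |t| < 1 }, where
     f t = sum_k 2^-k R_k^(-2 q_k) sin (R_k t)^(8 q_k),   R_k = L (q_k),
   and q_k grows very fast.  The amplitudes make f belong to the class Q_M, but
   as a function of x = t^2 its k-th term starts with 2^-k R_k^(6 q_k) x^(4 q_k),
   and this coefficient is larger than the order of magnitude L(n)^n, n = 4 q_k,
   which is allowed for the Taylor coefficients of a function of Q_M.  If F in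
   Q_M vanishes at points (x, f (sqrt x)) with x > 0 arbitrarily small, comparing
   F along the curve with F along the graph of a partial sum of the series shows
   that the jet of F at 0 vanishes, hence F = 0 near 0 by quasianalyticity; so a
   semianalytic description of the set would give it interior points.
   Quasianalyticity is reduced to functions of one variable, where it is Bang's
   theorem; the series of 1 / ((n + 3) ln (n + 3)) diverges because it dominates
   the telescoping series of L (n + 1) - L n. *)

(** * Functions of one variable *)

(** The obstruction comes from the substitution x = t^2: order 2n in t becomes order n in x, so
    coefficients of size about L(n)^(2n) compete with an allowed L(n)^n. With R = R_k and q = q_k,
    sin (R t)^(8 q) starts with R^(8 q) t^(8 q); the amplitude R^(-2 q) that keeps f in the class
    leaves R^(6 q) at order 4 q in x, where about R^(4 q) is allowed. Since x |-> f (sqrt x) is only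
    handled on x > 0, asymptotic expansions at 0+ take the place of Taylor series. The function F
    may depend on y only to high order, so its y-derivatives along the curve are treated one after
    the other. At the first one that is not flat, of order j and with leading exponent d, the
    comparison is raised to the power j: a coefficient of size R^(6 q j), up to geometric factors,
    at order n = 4 q j + d faces a bound (E R'^2 R)^(n + 3) with R' the preceding frequency. The
    factor R'^2 comes from the coefficients of the partial sum. As n + 3 <= 5 q j, it contributes
    R'^10 against one spare power of R, which is why R is chosen at least (k + 1) R'^10 when R' =
    R_k and R = R_(k+1). *)

Lemma mvt_seg (R : realType) (f f' : R -> R) (a b B : R) :
  a <= b -> (forall x, a <= x <= b -> is_derive x 1 f (f' x)) ->
  (forall x, a <= x <= b -> `|f' x| <= B) -> `|f b - f a| <= B * (b - a).
Proof.
move=> ab fd fB.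
have [||c] := @MVT_segment R f f' a b ab.
- by move=> x; rewrite in_itv /= => /andP[/ltW ax /ltW xb]; apply: fd; rewrite ax.
- apply: derivable_within_continuous => x; rewrite in_itv /= => xab.
  by case: (fd x xab).
- rewrite in_itv /= => cab ->.
  by rewrite normrM (ger0_norm (_ : 0 <= b - a)) ?subr_ge0// ler_wpM2r ?subr_ge0 ?fB.
Qed.

Definition between (R : realType) (a b x : R) := (a <= x <= b) || (b <= x <= a).

Lemma betweenl (R : realType) (a b : R) : between a b a.
Proof. by rewrite /between !lexx /=; case: (leP a b) => // /ltW ->. Qed.

Lemma betweenr (R : realType) (a b : R) : between a b b.
Proof. by rewrite /between !lexx !andbT; case: (leP a b) => // /ltW ->. Qed.

Lemma between_trans (R : realType) (a b x y : R) :
  between a b x -> between a x y -> between a b y.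
Proof. by rewrite /between; move=> /orP[]/andP[? ?] /orP[]/andP[? ?]; lra. Qed.

Lemma between_ball (R : realType) (c d a b x : R) :
  `|a - c| < d -> `|b - c| < d -> between a b x -> `|x - c| < d.
Proof.
rewrite /between !ltr_norml => /andP[? ?] /andP[? ?] /orP[]/andP[? ?]; lra.
Qed.

Lemma between_dist (R : realType) (a b x : R) :
  between a b x -> `|x - a| <= `|b - a|.
Proof.
move=> /orP[]/andP[? ?]; first by rewrite !ger0_norm; lra.
by rewrite !ler0_norm; lra.
Qed.

Lemma mvt_between (R : realType) (f f' : R -> R) (a b B : R) :
  (forall x, between a b x -> is_derive x 1 f (f' x)) ->
  (forall x, between a b x -> `|f' x| <= B) -> `|f b - f a| <= B * `|b - a|.
Proof.
move=> fd fB; case: (leP a b) => [ab|/ltW ba].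
  rewrite (ger0_norm (_ : 0 <= b - a)) ?subr_ge0//.
  by apply: (mvt_seg ab) => x xab; [apply: fd|apply: fB]; rewrite /between xab.
rewrite distrC (distrC b) (ger0_norm (_ : 0 <= a - b)) ?subr_ge0//.
by apply: (mvt_seg ba) => x xab; [apply: fd|apply: fB]; rewrite /between xab orbT.
Qed.

Lemma is_derive_taylor_term (R : realType) (a x c : R) n :
  is_derive x 1 (fun y => c * ((y - a) ^+ n.+1 / (n.+1)`!%:R))
                (c * ((x - a) ^+ n / n`!%:R)).
Proof.
have -> : (fun y => c * ((y - a) ^+ n.+1 / (n.+1)`!%:R)) =
   (c / (n.+1)`!%:R) *: ((fun y : R => y - a) ^+ n.+1 : R -> R).
  apply/funext => y; rewrite -[RHS]/(_ * _).
  by rewrite !exprfctE mulrA mulrAC.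
have dX : is_derive x 1 (fun y : R => y - a) 1.
  by rewrite -[X in is_derive _ _ _ X]subr0; apply: is_deriveB.
apply: is_derive_eq; rewrite /GRing.scale /= mulr1 factS natrM.
have : (n.+1)%:R != 0 :> R by rewrite pnatr_eq0.
have : n`!%:R != 0 :> R by rewrite pnatr_eq0 -lt0n fact_gt0.
by move=> ? ?; field; apply/andP.
Qed.

(* The factor 1/N! of the remainder is given up: no argument below needs it. *)
Lemma taylor (R : realType) N (F : nat -> R -> R) (a b B : R) :
  (forall n x, between a b x -> is_derive x 1 (F n) (F n.+1 x)) ->
  (forall x, between a b x -> `|F N x| <= B) ->
  `|F 0 b - \sum_(j < N) F j a * ((b - a) ^+ j / j`!%:R)| <= B * `|b - a| ^+ N.
Proof.
elim: N F b B => [|N IH] F b B Fd FB.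
  by rewrite big_ord0 subr0 expr0 mulr1 FB // betweenr.
pose r y := F 0 y - \sum_(j < N.+1) F j a * ((y - a) ^+ j / j`!%:R).
pose r' y := F 1%N y - \sum_(j < N) F j.+1 a * ((y - a) ^+ j / j`!%:R).
have ra : r a = 0.
  rewrite /r big_ord_recl big1 => [|i _]; last by rewrite subrr expr0n /= mul0r mulr0.
  by rewrite expr0 fact0 divr1 mulr1 addr0 subrr.
have B0 : 0 <= B by rewrite (le_trans _ (FB _ (betweenl _ _))).
have -> : F 0 b - \sum_(j < N.+1) F j a * ((b - a) ^+ j / j`!%:R) = r b - r a.
  by rewrite ra subr0.
rewrite exprSr mulrA; apply: (@mvt_between _ r r').
  move=> x xab.
  have -> : r = F 0 - ((fun _ => F 0 a) + \sum_(j < N)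
      (fun y => F j.+1 a * ((y - a) ^+ j.+1 / (j.+1)`!%:R))).
    apply/funext => y; rewrite /r big_ord_recl !fctE expr0 fact0 divr1 mulr1.
    by rewrite fct_sumE.
  have := Fd 0 x xab => ?.
  have dt (j : 'I_N) := is_derive_taylor_term a x (F j.+1 a) j.
  by apply: is_derive_eq; rewrite add0r.
move=> x xab.
apply: le_trans (IH (fun n => F n.+1) x B _ _) _.
- by move=> n y yax; apply/Fd/(between_trans xab).
- by move=> y yax; apply/FB/(between_trans xab).
apply: ler_wpM2l => //; apply: lerXn2r; rewrite ?nnegrE //.
exact: between_dist.
Qed.

(* Bang's argument: with s_n = sum_(n <= k < N) 1/(4 rho_k), the derivatives
   satisfy |h_k| <= 2^(k-n) W_k on [0, s_n]; going from n+1 to n only uses the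
   mean value inequality.  As N grows, s_n exceeds any given length. *)
Lemma bang (R : realType) (F : nat -> R -> R) (rho W : nat -> R) (T : R) :
  (forall n, 0 < rho n) -> (forall n, rho n <= rho n.+1) ->
  (forall n, 0 <= W n) -> (forall n, W n.+1 = rho n * W n) ->
  (forall n X, exists N, X <= \sum_(n <= k < N) (rho k)^-1) ->
  (forall n x, 0 <= x <= T -> is_derive x 1 (F n) (F n.+1 x)) ->
  (forall n x, 0 <= x <= T -> `|F n x| <= W n) ->
  (forall n, F n 0 = 0) -> forall x, 0 <= x <= T -> F 0 x = 0.
Proof.
move=> rho0 rhoS W0 WS rhodiv Fd FW F0 x xT.
have rho_homo : {homo rho : m n / (m <= n)%N >-> m <= n}.
  by apply: homo_leq => // ? ? ?; apply: le_trans.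
have key n : `|F 0 x| <= W 0 / 2 ^+ n.
  have [N HN] := rhodiv n (4 * T).
  pose s m : R := \sum_(m <= k < N) (rho k)^-1 / 4.
  have s_ge0 m : 0 <= s m by apply: sumr_ge0 => k _; rewrite divr_ge0 // invr_ge0 ltW.
  have triv m k y : 0 <= y <= T -> (m <= k)%N -> `|F k y| * 2 ^+ m <= W k * 2 ^+ k.
    move=> yT mk; apply: ler_pM => //; first exact: FW.
    by rewrite ler_weXn2l // ler1n.
  (* Descending induction on [m]: for [m >= N] the sum [s m] is empty and forces [y = 0]. The case
     [m = n], [k = 0] gives the claim, because [N] was chosen with [T <= s n]. *)
  suff Q : forall m y, 0 <= y <= T -> y <= s m -> forall k,
      `|F k y| * 2 ^+ m <= W k * 2 ^+ k.
    have := Q n x xT _ 0%N; rewrite expr0 mulr1 ler_pdivlMr ?exprn_gt0 //; apply.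
    rewrite /s -mulr_suml ler_pdivlMr // mulrC.
    by case/andP: xT => _ xT; apply: le_trans HN; rewrite ler_pM2l.
  move=> m.
  case: (leqP N m) => [Nm|/ltnW mN].
    move=> y yT; rewrite /s big_geq // => y0 k.
    have -> : y = 0 by case/andP: yT; lra.
    by rewrite F0 normr0 mul0r mulr_ge0 // exprn_ge0.
  rewrite -(subKn mN); move: (N - m)%N (leq_subr m N) => p.
  elim: p => [|p IH] pN y yT.
    rewrite subn0 /s big_geq // => y0 k.
    have -> : y = 0 by case/andP: yT; lra.
    by rewrite F0 normr0 mul0r mulr_ge0 // exprn_ge0.
  set m' := (N - p.+1)%N => ysm.
  have m'S : (N - p)%N = m'.+1 by rewrite /m' subnSK.
  have {}IH := IH (ltnW pN); rewrite m'S in IH.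
  have m'N : (m' < N)%N by rewrite /m' -subSn // leq_subLR addnC addnS ltnS leq_addr.
  have sE : s m' = (rho m')^-1 / 4 + s m'.+1 by rewrite /s big_ltn.
  case: (leP y (s m'.+1)) => [ys|ys] k.
    apply: le_trans (IH y yT ys k); apply: ler_wpM2l => //.
    by rewrite ler_weXn2l // ler1n.
  set x' := s m'.+1 in ys.
  case: (leqP m' k) => [|km]; first exact: triv.
  have yS : y <= (rho m')^-1 / 4 + x' by rewrite -sE.
  (* Orders [k >= m'] are covered by [triv]; lower ones follow by descending from [m'] on the strip
     above [x']. At order [j] the increment from [x'] costs half of [W j * 2 ^ j], the strip having
     width at most 1 / (4 rho m'). The value at [x'] costs the other half, by the outer induction,
     whose exponent is one larger. *)
  suff D i : (i <= m')%N -> forall z, x' <= z <= y ->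
      `|F (m' - i)%N z| * 2 ^+ m' <= W (m' - i)%N * 2 ^+ (m' - i).
    by rewrite -(subKn (ltnW km)); apply: D; rewrite ?leq_subr // lexx ltW.
  have zT z : x' <= z <= y -> 0 <= z <= T.
    have := s_ge0 m'.+1; case/andP: yT; rewrite -/x' => ? ? ? /andP[? ?]; lra.
  elim: i => [|i IHi] im z zx.
    by rewrite subn0; apply: triv => //; apply: zT.
  set j := (m' - i.+1)%N.
  have jS : (m' - i)%N = j.+1 by rewrite /j subnSK.
  have {}IHi := IHi (ltnW im); rewrite jS in IHi.
  have jm : (j <= m')%N by rewrite leq_subr.
  have zx' : x' <= z by case/andP: zx.
  have zy' : z <= y by case/andP: zx.
  have p2 k' : 0 < 2 ^+ k' :> R by rewrite exprn_gt0.
  have mv : `|F j z - F j x'| <= W j.+1 * 2 ^+ j.+1 / 2 ^+ m' * (z - x').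
    apply: (@mvt_seg _ (F j) (F j.+1) x' z) => // v /andP[v1 v2].
      by apply: Fd; apply: zT; rewrite v1 (le_trans v2).
    by rewrite ler_pdivlMr //; apply: IHi; rewrite v1 (le_trans v2).
  have hx' : `|F j x'| * 2 ^+ m'.+1 <= W j * 2 ^+ j.
    by apply: IH; rewrite ?lexx //; apply: zT; rewrite lexx ltW.
  have zd : z - x' <= (rho m')^-1 / 4 by lra.
  have rj : rho j * (z - x') <= 1 / 4.
    have zx0 : 0 <= z - x' by lra.
    apply: (@le_trans _ _ (rho m' * (z - x'))).
      by apply: ler_wpM2r => //; apply: rho_homo.
    apply: (@le_trans _ _ (rho m' * ((rho m')^-1 / 4))).
      by rewrite ler_pM2l.
    by rewrite mulrA divff ?gt_eqF // .
  have {}mv : `|F j z - F j x'| * 2 ^+ m' <= W j * 2 ^+ j / 2.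
    rewrite -ler_pdivlMr //; apply: le_trans mv _.
    rewrite WS exprS.
    have -> : rho j * W j * (2 * 2 ^+ j) / 2 ^+ m' * (z - x') =
       (rho j * (z - x')) * (2 * (W j * 2 ^+ j / 2 ^+ m')) by ring.
    have A0 : 0 <= 2 * (W j * 2 ^+ j / 2 ^+ m').
      by rewrite mulr_ge0 // divr_ge0 ?mulr_ge0 // ltW.
    apply: le_trans (ler_wpM2r A0 rj) _; lra.
  rewrite exprS in hx'.
  have tri : `|F j z| <= `|F j z - F j x'| + `|F j x'|.
    by rewrite -{1}(subrK (F j x') (F j z)) ler_normD.
  apply: le_trans (ler_wpM2r (ltW (p2 m')) tri) _.
  rewrite mulrDl; lra.
apply/eqP; rewrite -normr_eq0 eq_le normr_ge0 andbT leNgt; apply/negP => Fx0.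
have [n Hn] : exists n, W 0%N / `|F 0 x| < 2 ^+ n.
  exists (Num.truncn (W 0%N / `|F 0 x|)).+1.
  apply: lt_trans (truncnS_gt _) _.
  by rewrite -natrX ltr_nat ltn_expl.
have := key n; rewrite ler_pdivlMr ?exprn_gt0 //.
by rewrite ltr_pdivrMr // in Hn; rewrite leNgt mulrC Hn.
Qed.

(** * Quasianalyticity in several variables *)

Section Partials.
Variables (R : realType) (m : nat).
Implicit Types (f : 'rV[R]_m -> R) (U : set 'rV[R]_m) (x y : 'rV[R]_m) (i : 'I_m).

Definition incr_index (alpha : 'I_m -> nat) i n : 'I_m -> nat :=
  fun j => (alpha j + (j == i) * n)%N.

Lemma mdeg_incr alpha i n : mdeg (incr_index alpha i n) = (n + mdeg alpha)%N.
Proof.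
rewrite /mdeg /incr_index big_split /= addnC; congr addn.
by rewrite (bigD1 i) //= eqxx mul1n big1 ?addn0 // => j /negbTE ->.
Qed.

Lemma take_enum_ord i (j : 'I_m) : j \in take i (enum 'I_m) -> (j < i)%N.
Proof.
move=> ji; have : val j \in map val (take i (enum 'I_m)) by apply: map_f.
rewrite map_take val_enum_ord take_iota mem_iota => /andP[_].
by rewrite add0n leq_min => /andP[].
Qed.

Lemma foldr_iter0 (s : seq 'I_m) alpha f : {in s, forall j, alpha j = 0%N} ->
  foldr (fun i g => iter (alpha i) (@partial R m i) g) f s = f.
Proof.
elim: s => //= j s IH H; rewrite H ?inE ?eqxx //=; apply: IH => k ks.
by apply: H; rewrite inE ks orbT.
Qed.

Lemma mpartial0 alpha f : (forall j, alpha j = 0%N) -> mpartial alpha f = f.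
Proof. by move=> H; apply: foldr_iter0 => j _. Qed.

Lemma eq_mpartial alpha beta f : alpha =1 beta -> mpartial alpha f = mpartial beta f.
Proof. by move=> /funext ->. Qed.

(** [mpartial] folds over [enum 'I_m], so the lowest direction is differentiated last. When [alpha]
    has no direction below [i], one more derivative along [i] is therefore the outermost one. *)
Lemma mpartialS (alpha : 'I_m -> nat) i n f : (forall j : 'I_m, (j < i)%N -> alpha j = 0%N) ->
  mpartial (incr_index alpha i n.+1) f =
  partial i (mpartial (incr_index alpha i n) f).
Proof.
move=> a0; rewrite /mpartial.
have -> : enum 'I_m = take i (enum 'I_m) ++ i :: drop i.+1 (enum 'I_m).
  by rewrite -{2}(nth_ord_enum i i) -drop_nth ?cat_take_drop // size_enum_ord.
have un : i \notin drop i.+1 (enum 'I_m).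
  have := enum_uniq 'I_m.
  rewrite -{1}(cat_take_drop i (enum 'I_m)) cat_uniq => /and3P[_ _].
  by rewrite (drop_nth i) ?size_enum_ord // nth_ord_enum /= => /andP[].
have z k : {in take i (enum 'I_m), forall j, incr_index alpha i k j = 0%N}.
  move=> j /take_enum_ord ji; rewrite /incr_index a0 // (_ : j == i = false) //.
  by apply/eqP => ji'; rewrite ji' ltnn in ji.
rewrite !foldr_cat !(foldr_iter0 _ (z _)) /=.
rewrite {1 3}/incr_index eqxx !mul1n addnS iterS.
congr (partial i (iter _ _ _)).
elim: (drop _ _) un => //= j s IH; rewrite inE negb_or => /andP[ij js].
by rewrite (IH js) /incr_index eq_sym (negbTE ij).
Qed.

Lemma smooth_continuous U f x : smooth_on U f -> U x -> {for x, continuous f}.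
Proof. by move=> /(_ 0)[+ _]; apply. Qed.

Lemma smooth_derivable U f x i : smooth_on U f -> U x ->
  derivable f x (delta_mx 0 i).
Proof. by move=> /(_ 1%N)[_ /(_ i)[+ _]]; apply. Qed.

Lemma smooth_partial U f i : smooth_on U f -> smooth_on U (partial i f).
Proof. by move=> fU k; have [_ /(_ i)[]] := fU k.+1. Qed.

Lemma smooth_mpartial U f alpha : smooth_on U f -> smooth_on U (mpartial alpha f).
Proof.
move=> fU; rewrite /mpartial; elim: (enum _) => //= i s IH.
by elim: (alpha i) => //= n; apply: smooth_partial.
Qed.

Definition upd y i (t : R) : 'rV[R]_m := \row_j (if j == i then t else y 0 j).

Lemma upd_id y i : upd y i (y 0 i) = y.
Proof. by apply/rowP => j; rewrite mxE; case: eqP => // ->. Qed.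

Lemma updD y i t h : h *: delta_mx 0 i + upd y i t = upd y i (h + t).
Proof.
by apply/rowP => j; rewrite !mxE eqxx /=; case: eqP => _; rewrite ?mulr1 ?mulr0 ?add0r.
Qed.

Lemma diffquot_upd f y i t :
  (fun h : R => h^-1 *: (((fun s => f (upd y i s)) \o shift t) (h *: 1) - f (upd y i t)))
  = (fun h : R => h^-1 *: ((f \o shift (upd y i t)) (h *: delta_mx 0 i) - f (upd y i t))).
Proof. by apply/funext => h /=; rewrite updD [h *: 1]mulr1. Qed.

Lemma is_derive_upd f y i t : derivable f (upd y i t) (delta_mx 0 i) ->
  is_derive t 1 (fun s => f (upd y i s)) (partial i f (upd y i t)).
Proof.
by move=> fd; apply: DeriveDef; rewrite /derivable /partial /derive diffquot_upd.
Qed.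

Definition box x (e : R) : set 'rV[R]_m := [set y | forall j, `|y 0 j - x 0 j| < e].

Lemma nbhs_boxP x (W : set 'rV[R]_m) :
  nbhs x W <-> exists2 e : R, 0 < e & box x e `<=` W.
Proof.
split=> [/nbhs_ballP[e e0 eW]|[e e0 eW]].
  exists e => // y yx; apply: eW; split=> // i j; rewrite ord1.
  by rewrite -ball_normE /= distrC.
apply/nbhs_ballP; exists e => // y [_ yx]; apply: eW => j.
by have := yx 0 j; rewrite -ball_normE /= distrC.
Qed.

Lemma box_open x e : 0 < e -> open (box x e).
Proof.
move=> e0; rewrite openE => y yx; apply/nbhs_boxP.
pose d := \big[Order.min/e]_j (e - `|y 0 j - x 0 j|).
have d0 : 0 < d.
  by rewrite /d; elim/big_ind: _ => // [a b a0 b0|j _]; [rewrite lt_min a0|rewrite subr_gt0].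
exists d => // z zy j.
have dj : d <= e - `|y 0 j - x 0 j| by apply: ge_bigmin_seq; rewrite ?mem_index_enum.
have := zy j; have := ler_distD (y 0 j) (z 0 j) (x 0 j); lra.
Qed.

Lemma partial_near0 U f i : open U -> (forall x, U x -> f x = 0) ->
  forall x, U x -> partial i f x = 0.
Proof.
move=> Uo f0 x Ux; rewrite /partial /derive; apply: cvg_lim => //.
apply: cvg_near_cst; rewrite f0 //.
have /nbhs_boxP[e e0 eU] : nbhs x U by apply: open_nbhs_nbhs.
near=> h; rewrite /= f0 ?subr0 ?scaler0 //; apply: eU => j.
rewrite !mxE addrK eqxx /=; apply: (@le_lt_trans _ _ `|h|).
  by rewrite normrM ler_piMr //; case: eqP; rewrite ?normr1 ?normr0.
near: h; apply: dnbhs0_lt => //.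
Unshelve. all: by end_near. Qed.

Lemma mpartial_near0 U f alpha : open U -> (forall x, U x -> f x = 0) ->
  forall x, U x -> mpartial alpha f x = 0.
Proof.
move=> Uo f0; rewrite /mpartial; elim: (enum _) => //= i s IH.
by elim: (alpha i) => //= n; apply: partial_near0.
Qed.

End Partials.

(* B (n + a) bounds the n-th derivative of a function which is itself a
   derivative of order a. *)
Definition quasi_bound (R : realType) (B : nat -> R) :=
  forall (a : nat) (T : R) (F : nat -> R -> R),
  (forall n x, 0 <= x <= T -> is_derive x 1 (F n) (F n.+1 x)) ->
  (forall n x, 0 <= x <= T -> `|F n x| <= B (n + a)%N) ->
  (forall n, F n 0 = 0) -> forall x, 0 <= x <= T -> F 0 x = 0.

Lemma is_derive_affine (R : realType) (a s t : R) :
  is_derive t 1 (fun u => a + s * u) s.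
Proof.
have -> : (fun u => a + s * u) = cst a + s *: (@id R) by [].
have := @is_deriveD _ _ _ (cst a) (s *: (@id R)) t 1 0 (s *: 1).
rewrite add0r [s *: 1]mulr1; apply.
by have := @is_deriveZ _ R R (@id R) s t 1 1; rewrite [s *: 1]mulr1; apply.
Qed.

(* The coordinates are moved one at a time; since mpartial differentiates in
   the i-th direction after the directions j > i, no exchange of derivatives
   is needed. *)
Lemma vanish_on_box (R : realType) m (U : set 'rV[R]_m) f x e (B : nat -> R) :
  smooth_on U f -> box x e `<=` U -> quasi_bound B ->
  (forall alpha y, box x e y -> `|mpartial alpha f y| <= B (mdeg alpha)) ->
  (forall alpha, mpartial alpha f x = 0) ->
  forall y, box x e y -> f y = 0.
Proof.
move=> fU bU qB fB fx.
have P k : (k <= m)%N -> forall alpha : 'I_m -> nat,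
    (forall j : 'I_m, (j < k)%N -> alpha j = 0%N) ->
    forall y, box x e y -> (forall j : 'I_m, (k <= j)%N -> y 0 j = x 0 j) ->
    mpartial alpha f y = 0.
  elim: k => [|k IH] km alpha a0 y ye yx.
    by rewrite (_ : y = x) //; apply/rowP => j; rewrite yx.
  pose i := Ordinal km.
  (* [quasi_bound] speaks of intervals [0, T]; the sign [s] lets the same argument run to the left
     of [x 0 i]. *)
  pose t0 := y 0 i - x 0 i; pose s : R := if 0 <= t0 then 1 else -1.
  have ss : s * s = 1 by rewrite /s; case: ifP => _; rewrite ?mulrNN mulr1.
  have sN : `|s| = 1 by rewrite /s; case: ifP => _; rewrite ?normrN normr1.
  have st0 : s * t0 = `|t0|.
    rewrite /s; case: ifPn => [t0p|]; first by rewrite mul1r ger0_norm.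
    by rewrite -ltNge => t0n; rewrite mulN1r ltr0_norm.
  pose F n t := s ^+ n * mpartial (incr_index alpha i n) f (upd y i (x 0 i + s * t)).
  have inb (t : R) : 0 <= t <= `|t0| -> box x e (upd y i (x 0 i + s * t)).
    move=> /andP[t1 t2] j; rewrite mxE; case: eqP => [->|_]; last exact: ye.
    rewrite addrC addKr normrM sN mul1r ger0_norm //.
    by apply: le_lt_trans t2 _; apply: ye.
  have ai (j : 'I_m) : (j < i)%N -> alpha j = 0%N by move=> ji; apply: a0; apply: ltnW.
  have := qB (mdeg alpha) `|t0| F _ _ _ `|t0|.
  rewrite lexx normr_ge0 => Q.
  suff : F 0%N `|t0| = 0.
    rewrite /F -st0 mulrA ss mul1r /t0 (addrC (x 0 i)) subrK upd_id expr0 mul1r.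
    rewrite (@eq_mpartial _ _ _ alpha) // => j.
    by rewrite /incr_index muln0 addn0.
  apply: Q => // [n t tT|n t tT|n].
  - have ub := inb t tT.
    have dline := is_derive_affine (x 0 i) s t.
    have dm := @smooth_derivable _ _ U _ _ i
      (smooth_mpartial (incr_index alpha i n) fU) (bU _ ub).
    have := is_derive_upd dm; rewrite -(mpartialS n f ai) => du.
    have dc := @is_derive1_comp R (fun u => mpartial (incr_index alpha i n) f
      (upd y i u)) (fun u => x 0 i + s * u) t _ _ du dline.
    have -> : F n = s ^+ n *: ((fun u => mpartial (incr_index alpha i n) f
      (upd y i u)) \o (fun u => x 0 i + s * u)) by [].
    have := @is_deriveZ _ R R _ (s ^+ n) _ _ _ dc.
    rewrite [X in is_derive _ _ _ X -> _](_ : _ = F n.+1 t) // /F exprSr.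
    by rewrite -[LHS]/(_ * _); ring.
  - rewrite /F normrM normrX sN expr1n mul1r -(mdeg_incr alpha i).
    by apply: fB; apply: inb.
  - rewrite /F mulr0 addr0 IH ?mulr0 //; first exact: ltnW.
    + move=> j jk; rewrite /incr_index a0 //; last exact: ltnW.
      by rewrite (_ : j == i = false) //; apply/eqP => ji; rewrite ji ltnn in jk.
    + by have := inb 0; rewrite mulr0 addr0; apply; rewrite lexx /=.
    + move=> j kj; rewrite mxE; case: eqP => [->//|/eqP ji]; apply: yx.
      by rewrite ltn_neqAle kj andbT; apply: contra ji => /eqP kj'; apply/eqP/val_inj.
move=> y ye; rewrite -(@mpartial0 _ _ (fun=> 0%N) f) //.
by apply: (P m) => // j; rewrite leqNgt ltn_ord.
Qed.

Lemma dc_vanish_near (R : realType) (M : nat -> R) m (U : set 'rV[R]_m) f x :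
  (forall C r, 0 < C -> 0 < r -> quasi_bound (fun n => C * r ^+ n * n`!%:R * M n)) ->
  denjoy_carleman M U f -> U x -> (forall alpha, mpartial alpha f x = 0) ->
  exists2 e : R, 0 < e & box x e `<=` U /\ forall y, box x e y -> f y = 0.
Proof.
move=> qM [fU fM] Ux fx; have [W [Wx WU [C [r [C0 r0 CW]]]]] := fM x Ux.
have /nbhs_boxP[e e0 eW] := Wx.
exists e => //; split; first exact: subset_trans WU.
apply: (vanish_on_box fU (subset_trans eW WU) (qM C r C0 r0)) => //.
by move=> alpha y /eW; apply: CW.
Qed.

(** Connectedness argument: the set [Z] of points of [U] with vanishing jet is open by
    [dc_vanish_near], and closed in [U] because every partial derivative is continuous. *)
Lemma quasi_bound_quasianalytic (R : realType) (M : nat -> R) :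
  (forall C r, 0 < C -> 0 < r -> quasi_bound (fun n => C * r ^+ n * n`!%:R * M n)) ->
  quasianalytic M.
Proof.
move=> qM m U f a Uo Uc fM Ua fa x Ux.
pose Z := [set y | U y /\ forall alpha, mpartial alpha f y = 0].
have ZU : Z = U.
  apply: Uc; first by exists a.
    exists Z°; first exact: open_interior.
    rewrite eqEsubset; split=> y; last by case=> _ /interior_subset.
    case=> Uy fy; split=> //; have [e e0 [eU ef]] := dc_vanish_near qM fM Uy fy.
    apply/nbhs_boxP; exists e => // z ze; split; first exact: eU.
    by move=> alpha; exact: (@mpartial_near0 _ _ _ f alpha (box_open e0) ef z ze).
  exists (closure Z); first exact: closed_closure.
  rewrite eqEsubset; split=> y.
    by move=> Zy; split; [case: Zy|apply: subset_closure].
  case=> Uy Zy; split=> // alpha; apply/eqP; apply/negPn/negP => ne0.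
  have cf := smooth_continuous (smooth_mpartial alpha fM.1) Uy.
  have : nbhs y [set z | mpartial alpha f z != 0].
    by apply: (cvgr_neq0 _ cf ne0); apply: nbhs_filter.
  by move=> /Zy[z [[_ Zz] /=]]; rewrite Zz eqxx.
have : Z x by rewrite ZU.
by case=> _ /(_ (fun=> 0%N)); rewrite mpartial0.
Qed.

(** * The weight sequence *)

Section LogLog.
Variable R : realType.
Implicit Types (n k : nat).

Definition loglog n : R := ln (ln (n + 3)%:R).
Definition log3 n : R := ln (n + 3)%:R.
Local Notation L := loglog.

Lemma loglog_seqE n : loglog_seq R n = (L 0 ^+ 3)^-1 * L n ^+ (n + 3).
Proof. by []. Qed.

(** From 1 - 1/6 <= exp(-1/6) follows exp(1/6) <= 6/5, and (6/5)^6 = 2.985984 is just below 3. The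
    inequality gives ln 3 > 1, hence the positivity of every [loglog n]. *)
Lemma expR1_lt3 : expR 1 < 3 :> R.
Proof.
have -> : (1 : R) = 6%:R * 6^-1 by rewrite divff.
rewrite expRM_natl.
have h : expR (6^-1) <= 6 / 5 :> R.
  have := expR_ge1Dx (- 6^-1 : R); rewrite expRN => h.
  have h5 : (5 / 6 : R) <= (expR 6^-1)^-1 by apply: le_trans h; lra.
  rewrite -[leLHS]invrK -[leRHS]invrK lef_pV2 ?posrE ?invr_gt0 ?expR_gt0 //.
  by apply: le_trans h5; lra.
apply: (@le_lt_trans _ _ ((6 / 5) ^+ 6)).
  by rewrite lerXn2r ?nnegrE // ltW ?expR_gt0.
lra.
Qed.

Lemma log3_gt1 n : 1 < log3 n.
Proof.
rewrite -[ltLHS](@expRK R) ltr_ln ?posrE ?expR_gt0 ?ltr0n ?addn3 //.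
by apply: lt_le_trans expR1_lt3 _; rewrite ler_nat.
Qed.

Lemma log3_gt0 n : 0 < log3 n.
Proof. exact: lt_trans (log3_gt1 n). Qed.

Lemma loglog_gt0 n : 0 < L n.
Proof. exact: ln_gt0 (log3_gt1 n). Qed.

Lemma log3_homo : {homo log3 : m n / (m <= n)%N >-> m <= n}.
Proof. by move=> m n mn; rewrite ler_ln ?posrE ?ltr0n ?addn3 // ler_nat. Qed.

Lemma loglog_homo : {homo L : m n / (m <= n)%N >-> m <= n}.
Proof. by move=> m n mn; rewrite ler_ln ?posrE ?log3_gt0 //; apply: log3_homo. Qed.

Lemma ln_subr (a b : R) : 0 < a -> 0 < b -> ln b - ln a <= (b - a) / a.
Proof.
move=> a0 b0; rewrite -ln_div ?posrE //.
have -> : b / a = 1 + (b - a) / a by field; rewrite gt_eqF.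
apply: le_ln1Dx; have : 0 < b / a by rewrite divr_gt0.
rewrite mulrBl divff ?gt_eqF //; lra.
Qed.

Lemma loglog0_le1 : L 0 <= 1.
Proof.
have h1 : log3 0 <= 2.
  by have := @ln_subr 1 3 ltr01 (ltr0n _ 3); rewrite ln1 /log3 divr1; lra.
have := ln_subr ltr01 (log3_gt0 0); rewrite ln1 divr1 /loglog -/(log3 0); lra.
Qed.

Lemma loglog_le_log3 n : L n <= log3 n.
Proof. exact: ltW (ln_sublinear (log3_gt0 n)). Qed.

(** 1 / [rho n] is the derivative of ln ln at n + 3, and a constant multiple of [rho n] bounds the
    quotient of consecutive terms of n! M_n. Together the two facts give the divergence that [bang]
    requires. *)
Definition rho n : R := (n + 3)%:R * log3 n.

Lemma rho_gt0 n : 0 < rho n.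
Proof. by rewrite mulr_gt0 ?log3_gt0 ?ltr0n ?addn3. Qed.

Lemma rho_homo : {homo rho : m n / (m <= n)%N >-> m <= n}.
Proof.
move=> m n mn; apply: ler_pM; rewrite ?ler0n ?(ltW (log3_gt0 _)) ?ler_nat ?leq_add2r //.
exact: log3_homo.
Qed.

(* ln x <= x - 1, used for both logarithms *)
Lemma loglogS n : L n.+1 - L n <= (rho n)^-1.
Proof.
apply: le_trans (ln_subr (log3_gt0 n) (log3_gt0 n.+1)) _.
rewrite /rho invfM; apply: ler_wpM2r; first by rewrite invr_ge0 ltW ?log3_gt0.
have E : n.+4%:R - n.+3%:R = 1 :> R by rewrite -natrB // subSnn.
have := @ln_subr n.+3%:R n.+4%:R; rewrite E mul1r /log3 !addn3.
by apply; rewrite ltr0n.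
Qed.

Lemma loglog_unbounded (X : R) : exists n, X <= L n.
Proof.
exists (Num.truncn (expR (expR X))).
have h : expR (expR X) <= (Num.truncn (expR (expR X)) + 3)%:R.
  by apply: ltW; apply: lt_le_trans (truncnS_gt _) _; rewrite ler_nat addn3 ltnS leqW.
rewrite /loglog -[leLHS](@expRK R) ler_ln ?posrE ?expR_gt0 ?log3_gt0 //.
by rewrite -[leLHS](@expRK R) ler_ln ?posrE ?expR_gt0 // (lt_le_trans (expR_gt0 _) h).
Qed.

Lemma sum_rho (n N : nat) : (n <= N)%N ->
  L N - L n <= \sum_(n <= k < N) (rho k)^-1.
Proof.
move=> nN; rewrite -(telescope_sumr L) //.
by apply: ler_sum => k _; apply: loglogS.
Qed.

Definition ratio_cst : R := expR (2 / L 0).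

Lemma ratio_cst_gt0 : 0 < ratio_cst. Proof. exact: expR_gt0. Qed.

Lemma loglog_seq_gt0 n : 0 < loglog_seq R n.
Proof. by rewrite loglog_seqE mulr_gt0 ?invr_gt0 ?exprn_gt0 ?loglog_gt0. Qed.

(** [loglogS] reads L (n + 1) <= L n * (1 + e) with e = 1 / (rho n * L n). The power n + 4 of 1 + e
    is at most exp ((n + 4) e) <= [ratio_cst], and the one additional factor L n is enlarged to
    [log3 n], which matches [rho]. *)
Lemma loglog_seqS n : loglog_seq R n.+1 <= ratio_cst * log3 n * loglog_seq R n.
Proof.
rewrite !loglog_seqE mulrCA ler_pM2l ?invr_gt0 ?exprn_gt0 ?loglog_gt0 //.
have L0 := loglog_gt0 n; have l1 := log3_gt1 n; have l0 := log3_gt0 n.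
pose e := (rho n * L n)^-1.
have e0 : 0 < e by rewrite invr_gt0 mulr_gt0 ?rho_gt0.
have h1 : L n.+1 <= L n * (1 + e).
  rewrite mulrDr mulr1 /e invfM mulrCA divff ?gt_eqF // mulr1.
  by have := loglogS n; lra.
have h2 : (1 + e) ^+ (n + 4) <= ratio_cst.
  apply: (@le_trans _ _ (expR e ^+ (n + 4))).
    by rewrite lerXn2r ?nnegrE ?expR_ge1Dx ?expR_ge0 // addr_ge0 // ltW.
  rewrite -expRM_natl ler_expR /e /rho.
  rewrite ler_pdivrMr ?mulr_gt0 ?rho_gt0 ?ltr0n ?addn3 //.
  have a : (n + 4)%:R <= 2 * n.+3%:R :> R by rewrite -natrM ler_nat mul2n -addnn; lia.
  have b : 1 <= log3 n * L n / L 0.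
    rewrite -mulrA -[leLHS]mulr1; apply: ler_pM => //; first exact: ltW.
    by rewrite ler_pdivlMr ?loglog_gt0 // mul1r loglog_homo.
  apply: le_trans a _.
  have -> : 2 / L 0 * (n.+3%:R * log3 n * L n) = 2 * n.+3%:R * (log3 n * L n / L 0).
    by ring.
  by rewrite ler_peMr // mulr_ge0.
have -> : (n.+1 + 3 = n + 4)%N by lia.
apply: (@le_trans _ _ ((L n * (1 + e)) ^+ (n + 4))).
  by rewrite lerXn2r ?nnegrE // ?(ltW (loglog_gt0 _)) // mulr_ge0 ?addr_ge0 // ltW.
rewrite exprMn mulrC -mulrA ; apply: ler_pM => //.
- by rewrite exprn_ge0 // addr_ge0 // ltW.
- by rewrite exprn_ge0 // ltW.
rewrite addnS exprS; apply: ler_wpM2r; last exact: loglog_le_log3.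
by rewrite exprn_ge0 // ltW.
Qed.

(** [bang] asks for the exact relation [W n.+1 = rho n * W n], so the bounds [B (n + a)] are
    replaced by the larger products [W n]. Their ratios [rh] are multiples of a shift of [rho], and
    the inverses still have a divergent sum. *)
Lemma quasi_bound_loglog (C r : R) : 0 < C -> 0 < r ->
  quasi_bound (fun n => C * r ^+ n * n`!%:R * loglog_seq R n).
Proof.
move=> C0 r0 a T F Fd FB F0.
pose rh n := r * ratio_cst * rho (n + a)%N.
have rc0 : 0 < r * ratio_cst by rewrite mulr_gt0 ?ratio_cst_gt0.
have rh0 n : 0 < rh n by rewrite mulr_gt0 ?rho_gt0.
pose B n := C * r ^+ n * n`!%:R * loglog_seq R n.
have B0 n : 0 < B n.
  by rewrite mulr_gt0 ?loglog_seq_gt0 // !mulr_gt0 ?exprn_gt0 ?ltr0n ?fact_gt0.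
pose W n := B a * \prod_(k < n) rh k.
have W0 n : 0 <= W n.
  by apply: mulr_ge0; [exact: ltW|apply: prodr_ge0 => k _; exact: ltW].
have WS n : W n.+1 = rh n * W n by rewrite /W big_ord_recr /= mulrA mulrC.
have BS n : B n.+1 <= r * ratio_cst * rho n * B n.
  rewrite /B exprS factS natrM /rho.
  have s := loglog_seqS n; have p := loglog_seq_gt0 n; have l := log3_gt0 n.
  apply: (@le_trans _ _ (C * (r * r ^+ n) * (n.+1%:R * n`!%:R) *
    (ratio_cst * log3 n * loglog_seq R n))).
    apply: ler_wpM2l s; rewrite !mulr_ge0 ?exprn_ge0 // ltW //.
  have -> : C * (r * r ^+ n) * (n.+1%:R * n`!%:R) *
      (ratio_cst * log3 n * loglog_seq R n) = n.+1%:R * (r * ratio_cst * log3 n * B n).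
    by rewrite /B; ring.
  have -> : r * ratio_cst * ((n + 3)%:R * log3 n) * (C * r ^+ n * n`!%:R * loglog_seq R n)
     = (n + 3)%:R * (r * ratio_cst * log3 n * B n) by rewrite /B; ring.
  apply: ler_wpM2r; first by do 2![apply: mulr_ge0; last exact: ltW]; exact: ltW.
  by rewrite ler_nat addn3 ltnS leqW.
have BW n : B (n + a)%N <= W n.
  elim: n => [|n IH]; first by rewrite /W big_ord0 mulr1.
  by rewrite addSn; apply: le_trans (BS _) _; rewrite WS; apply: ler_wpM2l IH; exact: ltW (rh0 n).
apply: (@bang _ F rh W T) => //.
- by move=> n; rewrite /rh ler_pM2l // rho_homo // addSn.
- move=> n X.
  have [N0 HN0] := loglog_unbounded (r * ratio_cst * X + L (n + a)).
  exists (maxn N0 n).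
  have : r * ratio_cst * X <= \sum_(n + a <= k < maxn N0 n + a) (rho k)^-1.
    apply: le_trans (sum_rho _); last by rewrite leq_add2r leq_maxr.
    have : L N0 <= L (maxn N0 n + a).
      by apply: loglog_homo; apply: leq_trans (leq_maxl _ _) (leq_addr _ _).
    lra.
  rewrite big_addn addnK.
  rewrite -ler_pdivlMl // => H; apply: le_trans H _.
  rewrite mulr_sumr; apply: ler_sum => k _.
  by rewrite /rh [in leRHS]invfM.
- by move=> n x xT; apply: le_trans (FB n x xT) (BW n).
Qed.

Theorem loglog_quasianalytic : quasianalytic (loglog_seq R).
Proof. by apply: quasi_bound_quasianalytic => C r; apply: quasi_bound_loglog. Qed.

(* Unlike loglog_seq, wt satisfies wt m * wt n <= wt (m + n), as needed for the
   stability of the class under products; the quotients are at most C r^n. *)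
Definition wt n : R := (L n / L 0) ^+ n.

Lemma wt_base_ge1 n : 1 <= L n / L 0.
Proof. by rewrite ler_pdivlMr ?loglog_gt0 // mul1r loglog_homo. Qed.

Lemma wt_ge1 n : 1 <= wt n. Proof. exact: exprn_ege1 (wt_base_ge1 n). Qed.

Lemma wt_gt0 n : 0 < wt n. Proof. exact: lt_le_trans (wt_ge1 n). Qed.

Lemma wtD m n : wt m * wt n <= wt (m + n).
Proof.
rewrite /wt exprD; apply: ler_pM; rewrite ?exprn_ge0 ?divr_ge0 ?(ltW (loglog_gt0 _)) //.
  rewrite lerXn2r ?nnegrE ?divr_ge0 ?(ltW (loglog_gt0 _)) //.
  by rewrite ler_pM2r ?invr_gt0 ?loglog_gt0 // loglog_homo // leq_addr.
rewrite lerXn2r ?nnegrE ?divr_ge0 ?(ltW (loglog_gt0 _)) //.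
by rewrite ler_pM2r ?invr_gt0 ?loglog_gt0 // loglog_homo // leq_addl.
Qed.

Lemma wt_le_loglog_seq n : wt n <= (L 0)^-1 ^+ n * loglog_seq R n.
Proof.
have p0 := loglog_gt0 0.
have -> : (L 0)^-1 ^+ n * loglog_seq R n = wt n * (L n / L 0) ^+ 3.
  by rewrite loglog_seqE /wt exprD !exprMn !exprVn; ring.
by rewrite ler_peMr ?(ltW (wt_gt0 n)) // exprn_ege1 // wt_base_ge1.
Qed.

Lemma loglog_seq_le n : loglog_seq R n <= (L n / L 0) ^+ (n + 3).
Proof.
rewrite loglog_seqE exprMn mulrC; apply: ler_wpM2l.
  by rewrite exprn_ge0 // ltW ?loglog_gt0.
rewrite exprVn lef_pV2 ?posrE ?exprn_gt0 ?loglog_gt0 //.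
rewrite exprD ger_pMl ?exprn_gt0 ?loglog_gt0 //.
by rewrite exprn_ile1 // ?loglog0_le1 // ltW ?loglog_gt0.
Qed.

(** Squaring doubles the inner logarithm, and 2 <= e, so the outer one grows by at most 1. Hence
    weights at orders up to about q^2 are still controlled by the frequency L q. *)
Lemma loglog_sqr m n : (m + 3 <= (n + 3) ^ 2)%N -> L m <= 1 + L n.
Proof.
move=> mn; have l0 := log3_gt0 n.
have h : log3 m <= expR 1 * log3 n.
  have h1 : log3 m <= log3 n *+ 2.
    rewrite /log3 -lnXn ?ltr0n ?addn3 // ler_ln ?posrE ?exprn_gt0 ?ltr0n ?addn3 //.
    by rewrite -natrX ler_nat -(addn3 n) -(addn3 m).
  apply: le_trans h1 _; rewrite -[_ *+ 2]mulr_natl ler_pM2r //.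
  by have := expR_ge1Dx (1 : R); lra.
rewrite -{1}(@expRK R 1) /loglog -lnM ?posrE ?expR_gt0 //.
by rewrite ler_ln ?posrE ?mulr_gt0 ?expR_gt0 ?log3_gt0.
Qed.

End LogLog.
Arguments loglog : clear implicits.
Arguments wt : clear implicits.

(** * The oscillating function *)

Section Chains.
Variable R : realType.
Implicit Types (F G : nat -> R -> R) (n m : nat).

(* F n stands for the n-th derivative of F 0. *)
Definition chain F := forall n (x : R), is_derive x 1 (F n) (F n.+1 x).

(* Leibniz rule in a recursive form, which makes the bounds immediate. *)
Fixpoint mulc n F G : R -> R :=
  if n is n'.+1 then
    fun x => mulc n' (fun k => F k.+1) G x + mulc n' F (fun k => G k.+1) x
  else fun x => F 0 x * G 0 x.

Lemma mulc_chain F G : chain F -> chain G -> chain (fun n => mulc n F G).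
Proof.
move=> cF cG n; elim: n F G cF cG => [|n IH] F G cF cG x.
  have := @is_deriveM _ _ (F 0) (G 0) x 1 _ _ (cF 0 x) (cG 0 x).
  rewrite [X in is_derive _ _ _ X -> _](_ : _ = mulc 1 F G x) //=.
  by rewrite /GRing.scale /= addrC; congr (_ + _); rewrite mulrC.
apply: (@is_deriveD _ _ _ (mulc n (fun k => F k.+1) G) (mulc n F (fun k => G k.+1))).
- by apply: IH => // k y; apply: cF.
- by apply: IH => // k y; apply: cG.
Qed.

Lemma mulc_le F G (A B a b : R) : 0 <= a -> 0 <= b -> 0 <= A -> 0 <= B ->
  (forall k x, `|F k x| <= A * a ^+ k) -> (forall k x, `|G k x| <= B * b ^+ k) ->
  forall n x, `|mulc n F G x| <= A * B * (a + b) ^+ n.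
Proof.
move=> a0 b0 A0 B0 + + n; elim: n F G A B A0 B0 => [|n IH] F G A B A0 B0 FA GB x /=.
  have := FA 0 x; have := GB 0 x; rewrite !expr0 !mulr1 normrM => ? ?.
  exact: ler_pM.
have h1 : `|mulc n (fun k => F k.+1) G x| <= A * a * B * (a + b) ^+ n.
  apply: IH => //; first exact: mulr_ge0.
  by move=> k y; apply: le_trans (FA _ _) _; rewrite exprS mulrA.
have h2 : `|mulc n F (fun k => G k.+1) x| <= A * (B * b) * (a + b) ^+ n.
  apply: IH => //; first exact: mulr_ge0.
  by move=> k y; apply: le_trans (GB _ _) _; rewrite exprS mulrA.
apply: le_trans (ler_normD _ _) _; apply: le_trans (lerD h1 h2) _.
by rewrite exprS le_eqVlt; apply/orP; left; apply/eqP; ring.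
Qed.

Definition cstc (c : R) n (x : R) : R := if n is 0 then c else 0.

Lemma cstc_chain c : chain (cstc c).
Proof. by case=> [|n] x; apply: is_derive_cst. Qed.

Fixpoint powc m F n : R -> R :=
  if m is m'.+1 then mulc n F (powc m' F) else cstc 1 n.

Lemma powc_chain m F : chain F -> chain (powc m F).
Proof.
by move=> cF; elim: m => [|m IH]; [apply: cstc_chain|apply: mulc_chain].
Qed.

Lemma powc0 m F x : powc m F 0 x = F 0 x ^+ m.
Proof. by elim: m => //= m ->; rewrite exprS. Qed.

(** Under products amplitudes multiply and exponential types add. An amplitude equal to 1 is thus
    kept by every power, and only the type is multiplied by [m]. *)
Lemma powc_le m F (a : R) : 0 <= a -> (forall k x, `|F k x| <= a ^+ k) ->
  forall n x, `|powc m F n x| <= (m%:R * a) ^+ n.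
Proof.
move=> a0 Fa; elim: m => [|m IH] n x.
  by case: n => [|n] /=; rewrite ?normr1 ?expr0 // normr0 mul0r expr0n.
rewrite -natr1 mulrDl mul1r addrC -[leRHS]mul1r -[X in X * _]mulr1.
apply: mulc_le => //; first by rewrite mulr_ge0.
  by move=> k y; rewrite mul1r.
by move=> k y; rewrite mul1r.
Qed.

Fixpoint cosc (c : R) n : R -> R :=
  match n with
  | 0 => fun x => cos (c * x)
  | 1 => fun x => - c * sin (c * x)
  | n'.+2 => fun x => - c ^+ 2 * cosc c n' x
  end.

Lemma is_derive_scale (c x : R) : is_derive x 1 (fun y : R => c * y) c.
Proof.
have := @is_deriveZ _ R R (@id R) c x 1 1.
by rewrite [c *: 1]mulr1; apply; apply: is_derive_id.
Qed.

Lemma cosc_chain c : chain (cosc c).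
Proof.
move=> n; elim/ltn_ind: n => -[|[|n]] IH x.
- have := @is_derive1_comp R cos (fun y => c * y) x _ _
    (is_derive_cos _) (is_derive_scale c x).
  by rewrite (_ : _ * _ = cosc c 1 x) //= mulrC mulrN mulNr.
- have := @is_derive1_comp R sin (fun y => c * y) x _ _
    (is_derive_sin _) (is_derive_scale c x) => h.
  have := @is_deriveZ _ R R _ (- c) _ _ _ h.
  by rewrite (_ : _ *: _ = cosc c 2 x) //= /GRing.scale /=; ring.
- have := @is_deriveZ _ R R _ (- c ^+ 2) _ _ _ (IH n (leqnSn _) x).
  by [].
Qed.

Lemma cosc_le c n x : 0 <= c -> `|cosc c n x| <= c ^+ n.
Proof.
move=> c0; elim/ltn_ind: n => -[|[|n]] IH.
- by rewrite expr0 ler_norml cos_geN1 cos_le1.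
- rewrite /= expr1 normrM normrN (ger0_norm c0) ler_piMr //.
  by rewrite ler_norml sin_geN1 sin_le1.
- rewrite [cosc _ _ _]/= -[n.+2]/(2 + n)%N exprD normrM normrN (ger0_norm (exprn_ge0 2 c0)).
  by apply: ler_wpM2l; [rewrite exprn_ge0|apply: IH].
Qed.

Lemma cosc_even c n : cosc c n.*2 0 = (- c ^+ 2) ^+ n.
Proof. by elim: n => [|n IH]; [rewrite /= mulr0 cos0 expr0|rewrite exprS -IH]. Qed.

Lemma cosc_odd c n : cosc c n.*2.+1 0 = 0.
Proof. by elim: n => [|n /= ->]; rewrite ?mulr0 //= mulr0 sin0 mulr0. Qed.

(* sin^2 (r x) = (1 - cos (2 r x)) / 2 *)
Definition sinsqc (r : R) n (x : R) : R :=
  cstc 2^-1 n x - 2^-1 * cosc (2 * r) n x.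

Lemma sinsqc_chain r : chain (sinsqc r).
Proof.
move=> n x.
have h := @is_deriveZ _ R R _ 2^-1 _ _ _ (cosc_chain (2 * r) n x).
exact: (@is_deriveB _ _ _ _ _ x 1 _ _ (cstc_chain 2^-1 n x) h).
Qed.

Lemma sinsqc0_ge0 r x : 0 <= sinsqc r 0 x.
Proof. by rewrite /sinsqc /=; have := cos_le1 (2 * r * x); lra. Qed.

Lemma sinsqc0_le1 r x : sinsqc r 0 x <= 1.
Proof. by rewrite /sinsqc /=; have := cos_geN1 (2 * r * x); lra. Qed.

Lemma sinsqc_le r n x : 0 <= r -> `|sinsqc r n x| <= (2 * r) ^+ n.
Proof.
move=> r0; case: n => [|n].
  by rewrite expr0 ler_norml sinsqc0_le1 (le_trans _ (sinsqc0_ge0 _ _)) // lerN10.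
rewrite /sinsqc /cstc sub0r normrN normrM ger0_norm ?invr_ge0 //.
have := @cosc_le (2 * r) n.+1 x; rewrite mulr_ge0 // => /(_ isT).
have : 0 <= `|cosc (2 * r) n.+1 x| by [].
lra.
Qed.

Lemma sinsqc0_even r x : sinsqc r 0 (- x) = sinsqc r 0 x.
Proof. by rewrite /sinsqc /= mulrN cosN. Qed.

Lemma sinsqc0_le_sqr r x : 0 <= r -> sinsqc r 0 x <= 2 * r ^+ 2 * x ^+ 2.
Proof.
move=> r0; have c0 : 0 <= 2 * r by rewrite mulr_ge0.
have := @taylor R 2 (cosc (2 * r)) 0 x ((2 * r) ^+ 2)
  (fun n y _ => cosc_chain (2 * r) n y) (fun y _ => cosc_le 2 y c0).
rewrite !big_ord_recr big_ord0 /= !mulr0 cos0 sin0 !subr0 mulr0 mul0r addr0 add0r.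
rewrite expr0 divr1 mulr1 real_normK ?num_real // ler_norml => /andP[+ _].
rewrite /sinsqc /=; lra.
Qed.

(** A remainder of second order with a fixed constant determines the derivative. Such remainders can
    be summed over a series, which is how term-by-term differentiation is obtained. *)
Lemma is_derive_quadratic (f : R -> R) (x d K : R) :
  (forall h, `|f (x + h) - f x - h * d| <= K * h ^+ 2) -> is_derive x 1 f d.
Proof.
move=> H.
suff cv : (fun h : R => h^-1 *: ((f \o shift x) (h *: 1) - f x)) @ 0^' --> d.
  by apply: DeriveDef; [apply/cvg_ex; exists d|apply: cvg_lim].
apply/cvgrPdist_lt => e e0.
  have K0 : 0 <= K.
    by have := H 1; rewrite expr1n mulr1; apply: le_trans.
  have K1 : 0 < K + 1 by lra.
  near=> h.
  have h0 : h != 0 by near: h; apply: nbhs_dnbhs_neq.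
  have he : `|h| < e / (K + 1).
    by near: h; apply: dnbhs0_lt; rewrite divr_gt0.
  rewrite /= [h *: 1]mulr1.
  have -> : d - h^-1 *: (f (h + x) - f x) = - (h^-1 * (f (x + h) - f x - h * d)).
    rewrite -[_ *: _]/(h^-1 * (f (h + x) - f x)) (addrC h).
    by field.
  rewrite normrN normrM normfV ltr_pdivrMl ?normr_gt0 //.
  apply: le_lt_trans (H h) _.
  rewrite -(real_normK (num_real h)) expr2 mulrCA ltr_pM2l ?normr_gt0 //.
  move: he; rewrite ltr_pdivlMr // => he; have : 0 <= `|h| by []; lra.
Unshelve. all: by end_near. Qed.
End Chains.

(** * Geometrically dominated series and their term-by-term differentiation *)

Section Series.
Variable R : realType.
Implicit Types (a b : nat -> R) (A B : R).

Definition dominated a B := forall j, `|a j| <= B / 2 ^+ j.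

Definition tsum a : R := limn (series a).

Lemma dominated_cvg a B : dominated a B -> cvgn (series a).
Proof.
move=> aB; have B0 : 0 <= B by have := aB 0; rewrite expr0 divr1; apply: le_trans.
apply: normed_cvg; apply: (@series_le_cvg _ _ (geometric B 2^-1)) => //.
- by move=> n; apply: normr_ge0.
- by move=> n; apply: mulr_ge0 => //; apply: exprn_ge0; rewrite invr_ge0.
- by move=> n; apply: le_trans (aB n) _; rewrite -exprVn.
- by apply: is_cvg_geometric_series; rewrite ger0_norm //; lra.
Qed.

Lemma sum_half_le n : \sum_(k < n) (2 ^+ k)^-1 <= 2 :> R.
Proof.
suff -> : \sum_(k < n) (2 ^+ k)^-1 = 2 - 2 / 2 ^+ n :> R.
  by have : 0 <= 2 / 2 ^+ n :> R; [rewrite divr_ge0 ?exprn_ge0|lra].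
elim: n => [|n IH]; first by rewrite big_ord0 expr0; lra.
rewrite big_ord_recr /= IH exprS.
have : 2 ^+ n != 0 :> R by rewrite expf_neq0.
by move=> ?; field.
Qed.

Lemma tsum_le a B : dominated a B -> `|tsum a| <= 2 * B.
Proof.
move=> aB; have B0 : 0 <= B by have := aB 0; rewrite expr0 divr1; apply: le_trans.
have ca := dominated_cvg aB.
have H n : `|series a n| <= 2 * B.
  rewrite seriesEord /=; apply: le_trans (ler_norm_sum _ _ _) _.
  apply: (@le_trans _ _ (\sum_(k < n) B * (2 ^+ k)^-1)).
    by apply: ler_sum => k _; apply: aB.
  by rewrite -mulr_sumr mulrC; apply: ler_wpM2r => //; apply: sum_half_le.
rewrite ler_norml; apply/andP; split.
  by apply: limr_ge => //; near=> n; have := H n; rewrite ler_norml => /andP[].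
by apply: limr_le => //; near=> n; have := H n; rewrite ler_norml => /andP[].
Unshelve. all: by end_near. Qed.

Lemma dominatedD a b A B : dominated a A -> dominated b B ->
  dominated (fun j => a j + b j) (A + B).
Proof.
move=> aA bB j; rewrite mulrDl; apply: le_trans (ler_normD _ _) _.
by apply: lerD; [apply: aA|apply: bB].
Qed.

Lemma dominatedZ c a A : dominated a A -> dominated (fun j => c * a j) (`|c| * A).
Proof. by move=> aA j; rewrite normrM -mulrA ler_wpM2l. Qed.

Lemma tsumD a b A B : dominated a A -> dominated b B ->
  tsum (fun j => a j + b j) = tsum a + tsum b.
Proof.
move=> /dominated_cvg ca /dominated_cvg cb; apply: cvg_lim => //.
have -> : series (fun j => a j + b j) = series a \+ series b.
  by apply/funext => n; rewrite !seriesEord /= big_split.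
exact: cvgD.
Qed.

Lemma tsumZ c a A : dominated a A -> tsum (fun j => c * a j) = c * tsum a.
Proof.
move=> /dominated_cvg ca; apply: cvg_lim => //.
have -> : series (fun j => c * a j) = (fun n => c * series a n).
  by apply/funext => n; rewrite !seriesEord /= -mulr_sumr.
by apply: cvgMl_tmp.
Qed.

Lemma tsum_split k a A : dominated a A ->
  tsum a = \sum_(j < k) a j + tsum (fun j => a (j + k)%N).
Proof.
move=> aA; have ca := dominated_cvg aA.
have dA : dominated (fun j => a (j + k)%N) A.
  move=> j; apply: le_trans (aA _) _; apply: ler_wpM2l.
    by have := aA 0; rewrite expr0 divr1; apply: le_trans.
  by rewrite lef_pV2 ?posrE ?exprn_gt0 // ler_weXn2l ?leq_addr // ler1n.
have cd := dominated_cvg dA.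
apply: cvg_lim => //; rewrite -(cvg_shiftn k) /=.
have -> : (fun n => series a (n + k)%N) =
    (fun n => \sum_(j < k) a j + series (fun j => a (j + k)%N) n).
  apply/funext => n; rewrite !seriesEnat /= -(big_mkord xpredT a).
  rewrite (@big_cat_nat _ _ _ k) ?leq_addl //=; congr (_ + _).
  by rewrite -{1}(add0n k) big_addn addnK.
by apply: cvgD => //; apply: cvg_cst.
Qed.

(** By Taylor's formula of order 2, the j-th term has a remainder at most h^2 * B (n + 2) / 2^j, and
    these bounds sum to a multiple of h^2. *)
Lemma tsum_chain (E : nat -> nat -> R -> R) (B : nat -> R) :
  (forall j, chain (E j)) -> (forall n x, dominated (fun j => E j n x) (B n)) ->
  chain (fun n x => tsum (fun j => E j n x)).
Proof.
move=> cE dE n x; apply: (@is_derive_quadratic _ _ x _ (2 * B n.+2)) => h.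
have d0 := dE n (x + h); have d1 := dominatedZ (-1) (dE n x).
have d2 := dominatedZ (- h) (dE n.+1 x).
have -> : tsum (fun j => E j n (x + h)) - tsum (fun j => E j n x) -
    h * tsum (fun j => E j n.+1 x) =
   tsum (fun j => E j n (x + h) + -1 * E j n x + - h * E j n.+1 x).
  rewrite (tsumD (dominatedD d0 d1) d2) (tsumD d0 d1).
  by rewrite (tsumZ _ (dE n x)) (tsumZ _ (dE n.+1 x)); ring.
rewrite -mulrA; apply: tsum_le => j.
have := @taylor R 2 (fun k => E j (k + n)%N) x (x + h) (B n.+2 / 2 ^+ j).
rewrite !big_ord_recr big_ord0 /= add0r expr0 expr1 !divr1 mulr1.
rewrite (_ : x + h - x = h) ?(addrC x) ?addrK // real_normK ?num_real // => H.
rewrite [leRHS]mulrAC.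
apply: le_trans (H _ _); last by move=> y _; apply: dE.
  by rewrite le_eqVlt; apply/orP; left; apply/eqP; congr `|_|; rewrite /= add0n add1n; ring.
by move=> k y _; apply: cE.
Qed.

End Series.

(** * Lacunary frequencies and the oscillating series *)

Section Oscillation.
Variable R : realType.
Local Notation L := (loglog R).

Definition above (X : R) : nat := projT1 (cid (loglog_unbounded X)).

Lemma aboveP X : X <= L (above X).
Proof. by rewrite /above; case: cid. Qed.

(** [8 * q + 2] makes the terms after the k-th one of order at least 4 q + 1 in x, beyond the
    leading order 4 q of the k-th. The [above] clause yields [freqS], used in [freq_beats]. At the
    start, [expR 8] pays for the factor e^(8 q) in [term_dominated], and 2 ensures that every term
    is O(x). *)
Fixpoint qseq k : nat :=
  if k is k'.+1 then
    maxn (8 * qseq k' + 2) (above (k'.+1%:R * L (qseq k') ^+ 10))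
  else maxn 2 (above (expR 8)).

Definition freq k : R := L (qseq k).

Lemma qseqS k : (8 * qseq k + 2 <= qseq k.+1)%N.
Proof. exact: leq_maxl. Qed.

Lemma qseq_homo : {homo qseq : j k / (j <= k)%N}.
Proof.
apply: homo_leq => [//|? ? ?|k]; first exact: leq_trans.
by apply: leq_trans (qseqS k); lia.
Qed.

Lemma qseq_gt k : (k < qseq k)%N.
Proof.
elim: k => [|k IH]; first by apply: leq_trans (leq_maxl _ _).
by have := qseqS k; lia.
Qed.

Lemma freqS k : k.+1%:R * freq k ^+ 10 <= freq k.+1.
Proof.
apply: le_trans (aboveP _) _; apply: loglog_homo; exact: leq_maxr.
Qed.

Lemma freq_homo : {homo freq : j k / (j <= k)%N >-> j <= k}.
Proof. by move=> j k jk; apply/loglog_homo/qseq_homo. Qed.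

Lemma freq_ge k : expR 8 <= freq k.
Proof.
apply: (@le_trans _ _ (freq 0)); last exact: freq_homo.
by apply: le_trans (aboveP _) _; apply: loglog_homo; apply: leq_maxr.
Qed.

Lemma freq_ge9 k : 9 <= freq k.
Proof. by apply: le_trans (freq_ge k); have := expR_ge1Dx (8 : R); lra. Qed.

Lemma freq_gt0 k : 0 < freq k.
Proof. by apply: lt_le_trans (freq_ge9 k). Qed.

Definition amp k : R := (2 ^+ k * freq k ^+ (2 * qseq k))^-1.

Lemma amp_gt0 k : 0 < amp k.
Proof. by rewrite invr_gt0 mulr_gt0 ?exprn_gt0 ?freq_gt0. Qed.

Definition term k n x : R := amp k * powc (4 * qseq k) (sinsqc (freq k)) n x.

Lemma term_chain k : chain (term k).
Proof.
move=> n x; exact: (@is_deriveZ _ R R _ (amp k) _ _ _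
  (powc_chain (4 * qseq k) (sinsqc_chain (freq k)) n x)).
Qed.

Lemma expn_le_expR (x : R) n : 0 <= x -> x ^+ n <= n`!%:R * expR x.
Proof.
move=> x0; case: n => [|n].
  by rewrite expr0 fact0 mul1r; have := expR_ge1Dx x; lra.
rewrite mulrC -ler_pdivrMr ?ltr0n ?fact_gt0 //.
by have := expR_ge1Dxn n x0; lra.
Qed.

Definition oscb n : R := expR 8 ^+ n * n`!%:R * wt R n.

(* For n <= q the factor R^(-2q) pays for e^(8q); for n > q one has R <= L n. *)
Lemma term_dominated n x : dominated (fun k => term k n x) (oscb n).
Proof.
move=> k; rewrite /term /amp invfM normrM ger0_norm; last first.
  by rewrite mulr_ge0 // invr_ge0 exprn_ge0 // ltW ?freq_gt0.
rewrite -mulrA mulrC; apply: ler_wpM2r; first by rewrite invr_ge0 exprn_ge0.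
have f0 := freq_gt0 k; set q := qseq k; set r := freq k in f0 *.
have := @powc_le R (4 * q) (sinsqc r) (2 * r) _ _ n x.
rewrite mulr_ge0 ?(ltW f0) // => /(_ isT) H.
have {}H := H (fun m y => sinsqc_le m y (ltW f0)).
apply: (@le_trans _ _ ((r ^+ (2 * q))^-1 * ((8 * q%:R) ^+ n * r ^+ n))).
  apply: ler_wpM2l; first by rewrite invr_ge0 exprn_ge0 // ltW.
  apply: le_trans H _; rewrite -exprMn natrM.
  by rewrite le_eqVlt; apply/orP; left; apply/eqP; congr (_ ^+ _); ring.
have q0 : 0 <= 8 * q%:R :> R by rewrite mulr_ge0.
have e8 : 1 <= expR 8 :> R by have := expR_ge1Dx (8 : R); lra.
rewrite /oscb; have w1 := wt_ge1 R n; case: (leqP n q) => nq.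
  apply: (@le_trans _ _ n`!%:R); last first.
    rewrite -mulrA -[leLHS]mul1r; apply: ler_pM => //; first by rewrite exprn_ege1.
    by rewrite ler_peMr.
  rewrite ler_pdivrMl ?exprn_gt0 //.
  apply: (@le_trans _ _ (n`!%:R * expR (8 * q%:R) * r ^+ q)).
    apply: ler_pM; rewrite ?exprn_ge0 ?(ltW f0) //; first exact: expn_le_expR.
    by rewrite ler_weXn2l //; apply: le_trans (freq_ge9 k); rewrite ler1n.
  have -> : r ^+ (2 * q) * n`!%:R = n`!%:R * r ^+ q * r ^+ q.
    by rewrite mul2n -addnn exprD mulrC mulrA.
  apply: ler_wpM2r; first by rewrite exprn_ge0 // ltW.
  apply: ler_wpM2l => //; rewrite expRM_natr.
  by rewrite lerXn2r ?nnegrE ?expR_ge0 ?(ltW f0) // freq_ge.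
have rL : r <= L n by apply: loglog_homo; apply: ltnW.
have r1 : 1 <= r ^+ (2 * q).
  by rewrite exprn_ege1 //; apply: le_trans (freq_ge9 k); rewrite ler1n.
apply: (@le_trans _ _ ((8 * q%:R) ^+ n * r ^+ n)).
  rewrite ler_pdivrMl; last by apply: lt_le_trans r1.
  by rewrite ler_peMl // mulr_ge0 ?exprn_ge0 // ltW.
apply: ler_pM; rewrite ?exprn_ge0 ?(ltW f0) //.
  rewrite [leRHS]mulrC; apply: (@le_trans _ _ ((8 * n%:R) ^+ n)).
    apply: lerXn2r; rewrite ?nnegrE ?mulr_ge0 //; apply: ler_wpM2l => //.
    by rewrite ler_nat ltnW.
  by apply: le_trans (expn_le_expR _ _) _; rewrite ?mulr_ge0 // expRM_natr.
apply: (@le_trans _ _ (L n ^+ n)).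
  by rewrite lerXn2r ?nnegrE // ?(ltW f0) // ltW ?loglog_gt0.
rewrite /wt exprMn ler_peMr //; first by rewrite exprn_ge0 // ltW ?loglog_gt0.
by rewrite exprn_ege1 // invf_ge1 ?loglog_gt0 ?loglog0_le1.
Qed.

Definition osc n x : R := tsum (fun k => term k n x).

Lemma osc_chain : chain osc.
Proof. exact: tsum_chain term_chain term_dominated. Qed.

Lemma osc_le n x : `|osc n x| <= 2 * oscb n.
Proof. exact: tsum_le (term_dominated n x). Qed.

Lemma term0 k x : term k 0 x = amp k * sinsqc (freq k) 0 x ^+ (4 * qseq k).
Proof. by rewrite /term powc0. Qed.

Lemma osc_even x : osc 0 (- x) = osc 0 x.
Proof.
by congr tsum; apply/funext => k; rewrite !term0 sinsqc0_even.
Qed.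

(** Only [p] of the 4 q factors sin^2 are estimated, by 2 R^2 x^2 <= R^4 x^2, the others by 1. The
    resulting R^(4 p) is at most R^(2 q) and is cancelled by the amplitude. *)
Lemma term0_le k p x : (2 * p <= qseq k)%N ->
  `|term k 0 x| <= x ^+ (2 * p) / 2 ^+ k.
Proof.
move=> pq; have r9 := freq_ge9 k; have f0 := freq_gt0 k.
have s0 := sinsqc0_ge0 (freq k) x; have s1 := sinsqc0_le1 (freq k) x.
rewrite term0 ger0_norm; last by rewrite mulr_ge0 ?exprn_ge0 // ltW ?amp_gt0.
rewrite /amp invfM mulrC [leRHS]mulrC mulrCA; apply: ler_wpM2l.
  by rewrite invr_ge0 exprn_ge0.
rewrite ler_pdivrMr ?exprn_gt0 //.
apply: (@le_trans _ _ (sinsqc (freq k) 0 x ^+ p)).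
  by apply: ler_wiXn2l => //; lia.
apply: (@le_trans _ _ ((2 * freq k ^+ 2 * x ^+ 2) ^+ p)).
  rewrite lerXn2r ?nnegrE ?sinsqc0_le_sqr ?(ltW f0) //.
  by rewrite mulr_ge0 ?sqr_ge0 // mulr_ge0 ?sqr_ge0.
rewrite exprMn -exprM mulrC; apply: ler_wpM2l; first by rewrite exprM exprn_ge0 // sqr_ge0.
apply: (@le_trans _ _ (freq k ^+ (4 * p))).
  rewrite exprM (_ : 4 = 2 + 2)%N // lerXn2r ?nnegrE ?mulr_ge0 ?exprn_ge0 ?(ltW f0) //.
  rewrite exprD; apply: ler_pM; rewrite ?exprn_ge0 ?(ltW f0) //.
  by rewrite expr2 -[leLHS]mul1r; apply: ler_pM => //; lra.
by rewrite ler_weXn2l //; [lra|lia].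
Qed.

Lemma osc_split k p x : (2 * p <= qseq k)%N ->
  `|osc 0 x - \sum_(j < k) term j 0 x| <= 2 * x ^+ (2 * p).
Proof.
move=> pq; rewrite /osc (tsum_split k (term_dominated 0 x)) addrC addKr.
apply: tsum_le => j; apply: le_trans (@term0_le _ p x _) _.
  by apply: leq_trans pq _; apply: qseq_homo; apply: leq_addl.
apply: ler_wpM2l; first by rewrite exprM exprn_ge0 // sqr_ge0.
by rewrite lef_pV2 ?posrE ?exprn_gt0 // ler_weXn2l ?leq_addr // ler1n.
Qed.

End Oscillation.

(** * Asymptotic expansions at 0+ *)

Section Asymptotics.
Variable R : realType.
Implicit Types (f g : R -> R) (p q : {poly R}).

Definition isO (N : nat) f :=
  exists C d : R, [/\ 0 <= C, 0 < d & forall x, 0 < x < d -> `|f x| <= C * x ^+ N].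

(** The polynomial may have terms of degree [N] and higher; only its coefficients below [N] are
    determined by [f]. *)
Definition expd N f p := isO N (fun x => f x - p.[x]).

Lemma isO_le N f g (d : R) : 0 < d ->
  (forall x, 0 < x < d -> `|f x| <= `|g x|) -> isO N g -> isO N f.
Proof.
move=> d0 fg [C [e [C0 e0 H]]]; exists C, (Num.min d e); split=> //.
  by rewrite lt_min d0.
move=> x /andP[x0]; rewrite lt_min => /andP[xd xe].
by apply: le_trans (fg _ _) (H _ _); rewrite x0.
Qed.

Lemma eq_isO N f g : f =1 g -> isO N g -> isO N f.
Proof. by move=> /funext ->. Qed.

Lemma isO_widen m n f : (m <= n)%N -> isO n f -> isO m f.
Proof.
move=> mn [C [d [C0 d0 H]]]; exists C, (Num.min d 1); split=> //.
  by rewrite lt_min d0 ltr01.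
move=> x /andP[x0]; rewrite lt_min => /andP[xd x1].
apply: le_trans (H _ _) _; first by rewrite x0.
by apply: ler_wpM2l => //; rewrite ler_wiXn2l // ltW.
Qed.

Lemma isOD N f g : isO N f -> isO N g -> isO N (fun x => f x + g x).
Proof.
move=> [C [d [C0 d0 H]]] [C' [d' [C0' d0' H']]].
exists (C + C'), (Num.min d d'); split; [exact: addr_ge0|by rewrite lt_min d0|].
move=> x /andP[x0]; rewrite lt_min => /andP[xd xe].
apply: le_trans (ler_normD _ _) _; rewrite mulrDl.
by apply: lerD; [apply: H|apply: H']; rewrite x0.
Qed.

Lemma isOM m n f g : isO m f -> isO n g -> isO (m + n) (fun x => f x * g x).
Proof.
move=> [C [d [C0 d0 H]]] [C' [d' [C0' d0' H']]].
exists (C * C'), (Num.min d d'); split; [exact: mulr_ge0|by rewrite lt_min d0|].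
move=> x /andP[x0]; rewrite lt_min => /andP[xd xe].
rewrite normrM exprD mulrACA; apply: ler_pM => //.
  by apply: H; rewrite x0.
by apply: H'; rewrite x0.
Qed.

Lemma isO_cst (c : R) : isO 0 (fun=> c).
Proof. by exists `|c|, 1; split=> // x _; rewrite expr0 mulr1. Qed.

Lemma isO0 N : isO N (fun=> 0).
Proof. by exists 0, 1; split=> // x _; rewrite normr0 mul0r. Qed.

Lemma isOZ N c f : isO N f -> isO N (fun x => c * f x).
Proof. by move=> H; have := isOM (isO_cst c) H. Qed.

Lemma isOB N f g : isO N f -> isO N g -> isO N (fun x => f x - g x).
Proof.
move=> fN gN; apply: eq_isO (isOD fN (isOZ (-1) gN)) => x.
by rewrite mulN1r.
Qed.

Lemma isO_exp N n f : isO N f -> isO (N * n) (fun x => f x ^+ n).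
Proof.
move=> fN; elim: n => [|n IH].
  by rewrite muln0; apply: eq_isO (isO_cst 1) => x; rewrite expr0.
by rewrite mulnS; apply: eq_isO (isOM fN IH) => x; rewrite exprS.
Qed.

Lemma isO_sum N n (f : nat -> R -> R) : (forall i, (i < n)%N -> isO N (f i)) ->
  isO N (fun x => \sum_(i < n) f i x).
Proof.
elim: n => [|n IH] H.
  by apply: eq_isO (isO0 N) => x; rewrite big_ord0.
have {}IH := IH (fun i h => H i (ltnW h)).
by apply: eq_isO (isOD IH (H n (leqnn _))) => x; rewrite big_ord_recr.
Qed.

Lemma isO_X n : isO n (fun x => x ^+ n).
Proof.
exists 1, 1; split=> // x /andP[x0 _].
by rewrite mul1r ger0_norm // exprn_ge0 // ltW.
Qed.

Lemma isO_horner p : isO 0 (fun x => p.[x]).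
Proof.
apply: (@eq_isO _ _ (fun x => \sum_(i < size p) p`_i * x ^+ i)).
  by move=> x; rewrite horner_coef.
apply: (@isO_sum _ _ (fun i x => p`_i * x ^+ i)) => i _; apply: isOZ.
exact: isO_widen (isO_X i).
Qed.

Lemma expd_bounded N f p : expd N f p -> isO 0 f.
Proof.
move=> H; apply: eq_isO (isOD (isO_widen (leq0n N) H) (isO_horner p)) => x.
by rewrite subrK.
Qed.

Lemma expd0 N f : expd N f 0 <-> isO N f.
Proof. by split; apply: eq_isO => x; rewrite horner0 subr0. Qed.

Lemma expd_isO N f g p : expd N f p -> isO N (fun x => g x - f x) -> expd N g p.
Proof. by move=> H H'; apply: eq_isO (isOD H H') => x; ring. Qed.

Lemma expdM N f g p q : expd N f p -> expd N g q -> expd N (fun x => f x * g x) (p * q).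
Proof.
move=> H H'.
have h1 := isOM H (expd_bounded H'); rewrite addn0 in h1.
have h2 := isOM (isO_horner p) H'.
by apply: eq_isO (isOD h1 h2) => x; rewrite hornerM; ring.
Qed.

Lemma expdZ N c f p : expd N f p -> expd N (fun x => c * f x) (c *: p).
Proof. by move=> H; apply: eq_isO (isOZ c H) => x; rewrite hornerZ; ring. Qed.

Lemma expdX N n f p : expd N f p -> expd N (fun x => f x ^+ n) (p ^+ n).
Proof.
move=> H; elim: n => [|n IH].
  by apply: eq_isO (isO0 N) => x; rewrite !expr0 hornerC subrr.
rewrite exprS; apply: eq_isO (expdM H IH) => x.
by rewrite exprS.
Qed.

Lemma expd_sum N n (f : nat -> R -> R) (p : nat -> {poly R}) :
  (forall i, (i < n)%N -> expd N (f i) (p i)) ->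
  expd N (fun x => \sum_(i < n) f i x) (\sum_(i < n) p i).
Proof.
move=> H; apply: eq_isO (isO_sum H) => x.
by rewrite horner_sum -sumrB.
Qed.

Lemma horner_drop_poly n p x : (forall i, (i < n)%N -> p`_i = 0) ->
  p.[x] = x ^+ n * (drop_poly n p).[x].
Proof.
move=> p0; rewrite -{1}(poly_take_drop n p) hornerD hornerM hornerXn.
rewrite (_ : take_poly n p = 0) ?horner0 ?add0r 1?mulrC //.
by apply/polyP => i; rewrite coef_take_poly coef0; case: ltnP => // /p0.
Qed.

Lemma expd_coef N f p q : (forall i, (i < N)%N -> p`_i = q`_i) ->
  expd N f p -> expd N f q.
Proof.
move=> pq H.
have h : isO N (fun x => (p - q).[x]).
  have := isOM (isO_X N) (isO_horner (drop_poly N (p - q))); rewrite addn0.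
  apply: eq_isO => x; rewrite (@horner_drop_poly N) // => i iN.
  by rewrite coefB pq // subrr.
by apply: eq_isO (isOD H h) => x; rewrite hornerD hornerN; ring.
Qed.

(* The bound is only needed at arbitrarily small points. *)
Lemma coef_eq0_of_small N p (C : R) :
  (forall d, 0 < d -> exists x, 0 < x < d /\ `|p.[x]| <= C * x ^+ N) ->
  forall i, (i < N)%N -> p`_i = 0.
Proof.
move=> H i; elim/ltn_ind: i => n IH nN.
pose r := drop_poly n p; pose s := drop_poly 1 r.
have r0 : r`_0 = p`_n by rewrite coef_drop_poly add0n.
have rE x : r.[x] = p`_n + x * s.[x].
  rewrite -(poly_take_drop 1 r) hornerD hornerM hornerXn expr1 mulrC; congr (_ + _).
  by rewrite -r0 [take_poly 1 r]size1_polyC ?size_take_poly // coef_take_poly hornerC.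
have [K [d [K0 d0 HK]]] := isO_horner s.
apply/eqP; rewrite -normr_eq0 eq_le normr_ge0 andbT leNgt; apply/negP => pn0.
pose A := `|C| + K + 1.
have A0 : 0 < A by rewrite ltr_wpDl // addr_ge0.
have [|x [/andP[x0]]] := H (Num.min 1 (Num.min d (`|p`_n| / A))).
  by rewrite !lt_min ltr01 d0 divr_gt0.
rewrite !lt_min => /and3P[x1 xd xp].
rewrite (@horner_drop_poly n) => [|i ni]; last by rewrite IH // (ltn_trans ni).
have xn0 : 0 < x ^+ n by rewrite exprn_gt0.
rewrite normrM (ger0_norm (ltW xn0)) -(subnKC nN) exprD exprSr => h.
have {}h : `|r.[x]| <= `|C| * x.
  rewrite -(ler_pM2l xn0); apply: le_trans h _.
  apply: (@le_trans _ _ (`|C| * (x ^+ n * x * x ^+ (N - n.+1)))).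
    by apply: ler_wpM2r (ler_norm _); rewrite !mulr_ge0 ?exprn_ge0 // ltW.
  rewrite [leRHS]mulrCA; apply: ler_wpM2l => //.
  by rewrite ler_piMr ?mulr_ge0 ?exprn_ge0 ?exprn_ile1 // ltW.
have hs : `|s.[x]| <= K by have := HK x; rewrite x0 xd expr0 mulr1; apply.
have : `|p`_n| <= A * x.
  have -> : p`_n = r.[x] - x * s.[x] by rewrite rE addrK.
  apply: le_trans (ler_normB _ _) _; rewrite normrM (ger0_norm (ltW x0)).
  have : x * `|s.[x]| <= x * K by rewrite ler_pM2l.
  rewrite /A; lra.
by rewrite leNgt mulrC -ltr_pdivlMr ?xp.
Qed.

Lemma isO_coef N p : isO N (fun x => p.[x]) -> forall i, (i < N)%N -> p`_i = 0.
Proof.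
move=> [C [d [C0 d0 H]]]; apply: (@coef_eq0_of_small N p C) => e e0.
have m0 : 0 < Num.min d e by rewrite lt_min d0.
exists (Num.min d e / 2).
have /andP[h1 h2] : (0 < Num.min d e / 2) && (Num.min d e / 2 < Num.min d e) by lra.
split; first by rewrite h1 (lt_le_trans h2) // ge_min lexx orbT.
by apply: H; rewrite h1 (lt_le_trans h2) // ge_min lexx.
Qed.

Lemma expd_uniq N f p q : expd N f p -> expd N f q ->
  forall i, (i < N)%N -> p`_i = q`_i.
Proof.
move=> H H' i iN; apply/eqP; rewrite -subr_eq0 -coefB; apply/eqP.
apply: (@isO_coef N) iN; apply: eq_isO (isOB H' H) => x.
by rewrite hornerD hornerN; ring.
Qed.

(** The value c = 0 is allowed, so that leading terms multiply without side conditions. *)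
Definition lead n (c : R) f := isO n.+1 (fun x => f x - c * x ^+ n).

Lemma leadM m n a b f g : lead m a f -> lead n b g ->
  lead (m + n) (a * b) (fun x => f x * g x).
Proof.
move=> H H'.
have fm : isO m f.
  by apply: eq_isO (isOD (isO_widen (leqnSn m) H) (isOZ a (isO_X m))) => x; ring.
have h1 := isOM fm H'; have h2 := isOM H (isOZ b (isO_X n)).
rewrite addnS in h1; rewrite addSn in h2.
by apply: eq_isO (isOD h1 h2) => x; rewrite exprD; ring.
Qed.

Lemma leadX m n a f : lead m a f -> lead (m * n) (a ^+ n) (fun x => f x ^+ n).
Proof.
move=> H; elim: n => [|n IH].
  by rewrite muln0; apply: eq_isO (isO0 1) => x; rewrite !expr0; ring.
rewrite mulnS exprS; apply: eq_isO (leadM H IH) => x.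
by rewrite exprS.
Qed.

Lemma leadZ m a c f : lead m a f -> lead m (c * a) (fun x => c * f x).
Proof. by move=> H; apply: eq_isO (isOZ c H) => x; ring. Qed.

Lemma lead_isO m a f : lead m a f -> isO m f.
Proof.
move=> H.
by apply: eq_isO (isOD (isO_widen (leqnSn m) H) (isOZ a (isO_X m))) => x; ring.
Qed.

Lemma expd_lead N f p : expd N f p -> ~ isO N f ->
  exists d u, u != 0 /\ lead d u f.
Proof.
move=> H nf.
have ex : exists n, (n < N)%N && (p`_n != 0).
  apply: contrapT => nex; apply: nf; apply/expd0; apply: expd_coef H => i iN.
  rewrite coef0; apply/eqP/negPn/negP => pi; apply: nex.
  by exists i; rewrite iN.
case: (ex_minnP ex) => d /andP[dN pd] dmin.
exists d, p`_d; split=> //.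
have : expd d.+1 f (p`_d *: 'X^d).
  apply: (@expd_coef _ _ p); last exact: isO_widen H.
  move=> i; rewrite ltnS leq_eqVlt coefZ coefXn => /orP[/eqP ->|id].
    by rewrite eqxx mulr1.
  rewrite (ltn_eqF id) mulr0; apply/eqP/negPn/negP => pi.
  have := dmin i; rewrite pi (ltn_trans id dN) => /(_ isT).
  by rewrite leqNgt id.
by apply: eq_isO => x; rewrite hornerZ hornerXn.
Qed.

(** * Geometric bounds on polynomial coefficients *)

Definition coefle (p : {poly R}) (A B : R) := forall n, `|p`_n| <= A * B ^+ n.

(** As [p] has no constant term, the coefficient of degree n is at most the sum over i >= 1 of B^i
    D^(n - i), and B <= D / 2 bounds it by D^n. The radius [D] does not grow with the number of such
    factors, which matters because the powers 4 q are huge. *)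
Lemma coefleM p q (B D : R) : p`_0 = 0 -> coefle p 1 B -> coefle q 1 D ->
  0 <= B -> 2 * B <= D -> coefle (p * q) 1 D.
Proof.
move=> p0 pB qD B0 BD n; rewrite mul1r coefM.
have D0 : 0 <= D by lra.
rewrite big_ord_recl p0 mul0r add0r.
apply: le_trans (ler_norm_sum _ _ _) _.
apply: (@le_trans _ _ (\sum_(i < n) D ^+ n * (2^-1 * (2 ^+ i)^-1))).
  apply: ler_sum => i _; rewrite normrM lift0.
  have := pB i.+1; have := qD (n - i.+1)%N; rewrite !mul1r => h1 h2.
  apply: le_trans (ler_pM _ _ h2 h1) _ => //.
  have -> : D ^+ n = D ^+ i.+1 * D ^+ (n - i.+1) by rewrite -exprD subnKC.
  rewrite mulrAC; apply: ler_wpM2r; first by rewrite exprn_ge0.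
  rewrite -invfM -exprS ler_pdivlMr ?exprn_gt0 // -exprMn.
  by rewrite lerXn2r ?nnegrE ?mulr_ge0 // mulrC.
rewrite -mulr_sumr -mulr_sumr; apply: ler_piMr; first by rewrite exprn_ge0.
by have := sum_half_le R n; lra.
Qed.

Lemma coefleX p (B : R) n : p`_0 = 0 -> coefle p 1 B -> 0 <= B ->
  coefle (p ^+ n) 1 (2 * B).
Proof.
move=> p0 pB B0; elim: n => [|n IH].
  move=> i; rewrite expr0 coef1 mul1r; case: i => [|i] /=.
    by rewrite normr1 expr0.
  by rewrite normr0 exprn_ge0 // mulr_ge0.
by rewrite exprS; apply: coefleM pB IH _ _.
Qed.

Lemma coef_exp_eq0 p n i : p`_0 = 0 -> (i < n)%N -> (p ^+ n)`_i = 0.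
Proof.
move=> p0; have -> : p = drop_poly 1 p * 'X.
  rewrite -{1}(poly_take_drop 1 p) expr1 (_ : take_poly 1 p = 0) ?add0r //.
  by rewrite [take_poly 1 p]size1_polyC ?size_take_poly // coef_take_poly p0.
by move=> h; rewrite exprMn coefMXn h.
Qed.

End Asymptotics.

(** * Flatness along the curve *)

Arguments cosc : simpl nomatch.

Section OscExpansion.
Variable R : realType.

(** Taylor polynomial in x of (1 - cos (c sqrt x)) / 2, that is of sin (c sqrt x / 2)^2. *)
Definition sinsq_poly N (c : R) : {poly R} :=
  \poly_(n < N) (if n == 0%N then 0 else - ((- c ^+ 2) ^+ n / (2 * (n.*2)`!%:R))).

Lemma coef0_sinsq_poly N c : (sinsq_poly N c)`_0 = 0.
Proof. by rewrite coef_poly; case: ifP. Qed.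

Lemma sinsq_poly_coefle N c : coefle (sinsq_poly N c) 1 (c ^+ 2).
Proof.
move=> n; rewrite coef_poly mul1r; have c0 : 0 <= c ^+ 2 := sqr_ge0 c.
case: ifP => _; last by rewrite normr0 exprn_ge0.
case: ifP => _; first by rewrite normr0 exprn_ge0.
have f1 : 1 <= 2 * (n.*2)`!%:R :> R.
  by rewrite -natrM ler1n muln_gt0 fact_gt0.
rewrite normrN normrM normrX normrN (ger0_norm c0).
have i0 : 0 <= (2 * (n.*2)`!%:R)^-1 :> R by rewrite invr_ge0; apply: le_trans f1.
apply: ler_piMr; first exact: exprn_ge0.
by rewrite (ger0_norm i0) invf_le1 //; apply: lt_le_trans f1.
Qed.

Lemma cosc_taylor_sum (c t : R) N :
  \sum_(j < N.*2) cosc c j 0 * (t ^+ j / j`!%:R) =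
  \sum_(n < N) (- c ^+ 2) ^+ n / (n.*2)`!%:R * (t ^+ 2) ^+ n.
Proof.
elim: N => [|N IH]; first by rewrite !big_ord0.
rewrite doubleS !big_ord_recr IH /= cosc_even cosc_odd mul0r addr0.
by rewrite -exprM mul2n mulrA mulrAC.
Qed.

(** Odd derivatives of the cosine vanish at 0, so Taylor's formula of order 2 N in t = sqrt x is an
    expansion of order N in x. *)
Lemma sinsqc_expd N (r : R) : 0 <= r ->
  expd N (fun x => sinsqc r 0 (Num.sqrt x)) (sinsq_poly N (2 * r)).
Proof.
move=> r0; have c0 : 0 <= 2 * r by rewrite mulr_ge0.
case: N => [|N].
  exists 1, 1; split=> // x _.
  rewrite horner_poly big_ord0 subr0 expr0 mulr1 ger0_norm ?sinsqc0_ge0 //.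
  exact: sinsqc0_le1.
set c := 2 * r in c0 *.
exists (c ^+ (N.+1).*2), 1; split=> //; first exact: exprn_ge0.
move=> x /andP[x0 _]; set t := Num.sqrt x.
have t2 : t ^+ 2 = x by rewrite sqr_sqrtr // ltW.
have tN : t ^+ (N.+1).*2 = x ^+ N.+1 by rewrite -t2 -exprM mul2n.
have := @taylor R (N.+1).*2 (cosc c) 0 t (c ^+ (N.+1).*2)
  (fun n y _ => cosc_chain c n y) (fun y _ => cosc_le _ y c0).
rewrite subr0 cosc_taylor_sum t2 (ger0_norm (sqrtr_ge0 x : 0 <= t)) tN.
rewrite horner_poly !big_ord_recl /= !expr0 ?fact0 ?divr1 ?mulr1 ?mul0r ?add0r.
set S := \sum_(i < N) _; set S' := \sum_(i < N) _ => h.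
have SS : S' = - (2^-1 * S).
  rewrite /S /S' mulr_sumr -sumrN; apply: eq_bigr => i _.
  by rewrite /bump /= add1n invfM; ring.
apply: le_trans h; rewrite /sinsqc /= -/c SS.
have -> : 2^-1 - 2^-1 * cos (c * t) - - (2^-1 * S) = - (2^-1 * (cos (c * t) - (1 + S))).
  by ring.
rewrite normrN normrM ger0_norm ?invr_ge0 // ler_piMl //; lra.
Qed.

Lemma sinsqc_lead (r : R) : 0 <= r ->
  lead 1 (r ^+ 2) (fun x => sinsqc r 0 (Num.sqrt x)).
Proof.
move=> r0; apply: eq_isO (sinsqc_expd 2 r0) => x.
rewrite horner_poly !big_ord_recr big_ord0 /= mul0r !add0r !expr1.
rewrite (_ : (1.*2)`!%:R = 2) //; congr (_ - _).
by field.
Qed.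

Lemma term_expd k N : expd N (fun x => term k 0 (Num.sqrt x))
  (amp R k *: sinsq_poly N (2 * freq R k) ^+ (4 * qseq R k)).
Proof.
apply: eq_isO (expdZ (amp R k) (expdX (4 * qseq R k)
  (sinsqc_expd N (ltW (freq_gt0 R k))))) => x.
by rewrite term0.
Qed.

Lemma term_lead k : lead (4 * qseq R k) (amp R k * freq R k ^+ (8 * qseq R k))
  (fun x => term k 0 (Num.sqrt x)).
Proof.
have := leadZ (amp R k) (leadX (4 * qseq R k) (sinsqc_lead (ltW (freq_gt0 R k)))).
rewrite mul1n -exprM mulnA; apply: eq_isO => x.
by rewrite term0.
Qed.

(* The function x |-> f (sqrt x), f being osc 0. *)
Definition osq (x : R) : R := osc 0 (Num.sqrt x).
Definition partial_osq k (x : R) : R := \sum_(j < k) term j 0 (Num.sqrt x).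
Definition osq_poly k N : {poly R} :=
  \sum_(j < k) (amp R j *: sinsq_poly N (2 * freq R j) ^+ (4 * qseq R j)).

Lemma partial_osq_expd k N : expd N (partial_osq k) (osq_poly k N).
Proof.
exact: (@expd_sum R N k (fun j x => term j 0 (Num.sqrt x))
  (fun j => amp R j *: sinsq_poly N (2 * freq R j) ^+ (4 * qseq R j))
  (fun j _ => term_expd j N)).
Qed.

Lemma osq_tail k p : (2 * p <= qseq R k)%N ->
  isO p (fun x => osq x - partial_osq k x).
Proof.
move=> pq; exists 2, 1; split=> // x /andP[x0 _].
by have := osc_split (Num.sqrt x) pq; rewrite exprM sqr_sqrtr // ltW.
Qed.

Lemma qseq_ge2 k : (2 <= qseq R k)%N.
Proof. by apply: leq_trans (qseq_homo R (leq0n k)); apply: leq_maxl. Qed.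

Lemma osq_isO : isO 1 osq.
Proof.
apply: eq_isO (@osq_tail 0 1 _) => [x|]; last exact: qseq_ge2.
by rewrite /partial_osq big_ord0 subr0.
Qed.

Lemma partial_osq_isO k : isO 1 (partial_osq k).
Proof.
apply: eq_isO (isOB osq_isO (@osq_tail k 1 (qseq_ge2 k))) => x.
by ring.
Qed.

Lemma osq_expd N : exists p, expd N osq p.
Proof.
exists (osq_poly N.*2 N); apply: expd_isO (partial_osq_expd N.*2 N) _.
by apply: osq_tail; rewrite mul2n; apply/ltnW/qseq_gt.
Qed.

Lemma osq_remainder_lead k :
  lead (4 * qseq R k) (amp R k * freq R k ^+ (8 * qseq R k))
    (fun x => osq x - partial_osq k x).
Proof.
have h : isO (4 * qseq R k).+1 (fun x => osq x - partial_osq k.+1 x).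
  by apply: osq_tail; apply: leq_trans (qseqS R k); lia.
apply: eq_isO (isOD h (term_lead k)) => x.
rewrite /partial_osq big_ord_recr /=.
by move: (\sum_(i < k) _) (amp R k * _ * _) (term _ _ _) (osq x) => a b c e; ring.
Qed.

Lemma coef0_osq_poly k N : (osq_poly k N)`_0 = 0.
Proof.
rewrite coef_sum big1 // => j _; rewrite coefZ coef_exp_eq0 ?mulr0 //.
  exact: coef0_sinsq_poly.
by rewrite muln_gt0 /=; apply: leq_trans (qseq_ge2 j).
Qed.

Lemma amp_le k : amp R k <= (2 ^+ k)^-1.
Proof.
rewrite /amp lef_pV2 ?posrE ?mulr_gt0 ?exprn_gt0 ?freq_gt0 //.
rewrite ler_peMr ?exprn_ge0 // exprn_ege1 //.
by apply: le_trans (freq_ge9 R k); rewrite ler1n.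
Qed.

(** [coefleX] bounds the coefficients of each power by (8 R_j^2)^n, whatever the exponent 4 q_j. The
    amplitudes sum to at most 2, which is absorbed by 16 = 2 * 8 for n >= 1; at n = 0 the
    coefficient vanishes. *)
Lemma osq_poly_coefle k N : coefle (osq_poly k.+1 N) 1 (16 * freq R k ^+ 2).
Proof.
move=> n; have f0 := freq_gt0 R k.
have g0 : 0 <= 8 * freq R k ^+ 2 by rewrite mulr_ge0 ?sqr_ge0.
case: n => [|n]; first by rewrite coef0_osq_poly normr0 expr0 mulr1.
rewrite mul1r coef_sum; apply: le_trans (ler_norm_sum _ _ _) _.
apply: (@le_trans _ _ (\sum_(j < k.+1) (2 ^+ j)^-1 * (8 * freq R k ^+ 2) ^+ n.+1)).
  apply: ler_sum => j _; rewrite coefZ normrM.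
  rewrite (ger0_norm (ltW (amp_gt0 R j))); apply: ler_pM => //.
  - exact: ltW (amp_gt0 R j).
  - exact: amp_le.
  have := @coefleX R _ ((2 * freq R j) ^+ 2) (4 * qseq R j)
    (coef0_sinsq_poly N (2 * freq R j)) (sinsq_poly_coefle N (2 * freq R j))
    (sqr_ge0 _) n.+1.
  rewrite mul1r => h; apply: le_trans h _.
  apply: lerXn2r; rewrite ?nnegrE //; first by rewrite mulr_ge0 ?sqr_ge0.
  rewrite (_ : 2 * (2 * freq R j) ^+ 2 = 8 * freq R j ^+ 2); last by ring.
  apply: ler_wpM2l => //; apply: lerXn2r; rewrite ?nnegrE ?(ltW (freq_gt0 R _)) //.
  by apply: freq_homo; rewrite -ltnS.
rewrite -mulr_suml.
have -> : 16 * freq R k ^+ 2 = 2 * (8 * freq R k ^+ 2) by rewrite mulrA -natrM.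
rewrite [leRHS]exprMn; apply: ler_wpM2r; first exact: exprn_ge0.
apply: le_trans (sum_half_le R k.+1) _.
by rewrite exprS ler_peMr // exprn_ege1 // ler1n.
Qed.

End OscExpansion.

(** With f and F the two frequencies, (E f^2 F)^5 = E^5 f^10 F^5 is at most E^5 / (k + 1) * F^6 by
    [freqS]. Taking [k] beyond E^5 and K E^5 / u makes the comparison strict. The lower bound on [k]
    will give d < 4 q and leave room for d + 3 in the exponent 5 q j. *)
Lemma freq_beats (R : realType) (u K E : R) (j d : nat) :
  0 < u -> 0 <= K -> 1 <= E -> (0 < j)%N ->
  exists k, (4 * j + d + 3 <= k)%N /\
   K * (E * freq R k ^+ 2 * freq R k.+1) ^+ (5 * (qseq R k.+1 * j)) <
   u * freq R k.+1 ^+ (6 * (qseq R k.+1 * j)).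
Proof.
move=> u0 K0 E1 j0.
exists (4 * j + d + 3 + (Num.truncn (E ^+ 5) + Num.truncn (K * E ^+ 5 / u)))%N.
set k := (_ + (_ + _))%N; split; first by rewrite leq_addr.
have k1 : E ^+ 5 < k.+1%:R.
  apply: lt_le_trans (truncnS_gt _) _; rewrite ler_nat ltnS /k.
  exact: leq_trans (leq_addr _ _) (leq_addl _ _).
have k2 : K * E ^+ 5 < k.+1%:R * u.
  rewrite -ltr_pdivrMr //; apply: lt_le_trans (truncnS_gt _) _.
  by rewrite ler_nat ltnS /k; apply: leq_trans (leq_addl _ _) (leq_addl _ _).
clearbody k; have m0 : (0 < qseq R k.+1 * j)%N.
  by rewrite muln_gt0 j0 andbT; apply: leq_trans (qseq_ge2 R k.+1).
have f0 := freq_gt0 R k; have F0 := freq_gt0 R k.+1; have fF := freqS R k.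
move: (qseq R k.+1 * j)%N m0 (freq R k) (freq R k.+1) f0 F0 fF => m m0 f F f0 F0 fF.
have kp : 0 < k.+1%:R :> R by rewrite ltr0n.
have E0 : 0 < E by lra.
rewrite !exprM; pose t := E ^+ 5 / k.+1%:R.
have t0 : 0 <= t by rewrite divr_ge0 // exprn_ge0 // ltW.
have t1 : t <= 1 by rewrite ler_pdivrMr // mul1r ltW.
have h : (E * f ^+ 2 * F) ^+ 5 <= t * F ^+ 6.
  have -> : (E * f ^+ 2 * F) ^+ 5 = f ^+ 10 * (E ^+ 5 * F ^+ 5) by ring.
  have -> : t * F ^+ 6 = F / k.+1%:R * (E ^+ 5 * F ^+ 5) by rewrite /t; ring.
  apply: ler_wpM2r; first by rewrite mulr_ge0 ?exprn_ge0 // ltW.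
  by rewrite ler_pdivlMr // mulrC.
have b0 : 0 <= (E * f ^+ 2 * F) ^+ 5.
  by rewrite exprn_ge0 // !mulr_ge0 ?exprn_ge0 // ltW.
apply: (@le_lt_trans _ _ (K * (t * F ^+ 6) ^+ m)).
  by apply: ler_wpM2l => //; rewrite lerXn2r // nnegrE // (le_trans b0).
apply: (@le_lt_trans _ _ (K * (t * (F ^+ 6) ^+ m))).
  apply: ler_wpM2l => //; rewrite exprMn; apply: ler_wpM2r.
    by rewrite !exprn_ge0 // ltW.
  by case: (m) m0 => // m' _; rewrite exprS ler_piMr // exprn_ile1.
rewrite mulrA ltr_pM2r; last by rewrite !exprn_gt0.
by rewrite /t mulrA ltr_pdivrMr // (mulrC u).
Qed.

(** All factors are gathered into one power, using (n + 1)^2 <= 4^n and 2^k <= 2^n: 1024 is 2 * 4 *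
    2 * 2 * 16, times the 2 of y <= 2 F. *)
Lemma coef_bound_collect (R : realType) (C r l f F y : R) (n k N : nat) :
  0 <= C -> 1 <= r -> 0 < l <= 1 -> 1 <= f -> 1 <= F -> 0 <= y <= 2 * F ->
  (k <= n)%N -> (n + 3 <= N)%N ->
  2 ^+ k * (n.+1%:R ^+ 2 * (C * (2 * r) ^+ n * (y / l) ^+ (n + 3) *
    (2 * (16 * f ^+ 2)) ^+ n)) <= C * (1024 * r / l * f ^+ 2 * F) ^+ N.
Proof.
move=> C0 r1 /andP[l0 l1] f1 F1 /andP[y0 yF] kn nN.
have r0 : 0 <= r by lra.
have f2 : 1 <= f ^+ 2 by rewrite exprn_ege1.
have f20 : 0 <= f ^+ 2 by apply: le_trans f2.
have li : 1 <= l^-1 by rewrite invf_ge1.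
have s0 : 0 <= C * (2 * r) ^+ n * (y / l) ^+ (n + 3) * (2 * (16 * f ^+ 2)) ^+ n.
  have a0 : 0 <= 2 * r by lra.
  have b0 : 0 <= y / l by rewrite divr_ge0 // ltW.
  have c0 : 0 <= 2 * (16 * f ^+ 2) by lra.
  by rewrite !mulr_ge0 ?exprn_ge0.
have h4 : n.+1%:R ^+ 2 <= 4 ^+ n :> R.
  by rewrite -!natrX ler_nat (_ : 4 = 2 ^ 2)%N // -expnM mulnC expnM leq_exp2r // ltn_expl.
apply: (@le_trans _ _ (2 ^+ n * (4 ^+ n * (C * (2 * r) ^+ n * (y / l) ^+ (n + 3) *
    (2 * (16 * f ^+ 2)) ^+ n)))).
  apply: ler_pM; rewrite ?exprn_ge0 //.
  - by apply: mulr_ge0 => //; rewrite exprn_ge0.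
  - by rewrite ler_weXn2l // ler1n.
  - exact: ler_wpM2r.
have -> : 2 ^+ n * (4 ^+ n * (C * (2 * r) ^+ n * (y / l) ^+ (n + 3) *
    (2 * (16 * f ^+ 2)) ^+ n)) = C * ((512 * r * f ^+ 2) ^+ n * (y / l) ^+ (n + 3)).
  have -> : 512 * r * f ^+ 2 = 2 * (4 * (2 * r * (2 * (16 * f ^+ 2)))) by ring.
  by rewrite !exprMn; ring.
apply: ler_wpM2l => //.
have a1 : 1 <= 512 * r * f ^+ 2.
  by rewrite -[leLHS]mulr1; apply: ler_pM => //; lra.
have b0 : 0 <= y / l by rewrite divr_ge0 // ltW.
have b1 : y / l <= 2 * F / l by rewrite ler_pM2r ?invr_gt0.
have b2 : 1 <= 2 * F / l.
  by rewrite -[leLHS]mulr1; apply: ler_pM => //; lra.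
have -> : 1024 * r / l * f ^+ 2 * F = (512 * r * f ^+ 2) * (2 * F / l) by ring.
move: (512 * r * f ^+ 2) (y / l) (2 * F / l) a1 b0 b1 b2 => X Y Z X1 Y0 YZ Z1.
have X0 : 0 <= X by lra.
apply: (@le_trans _ _ ((X * Z) ^+ (n + 3))); last first.
  by rewrite ler_weXn2l // -[leLHS]mulr1; apply: ler_pM.
rewrite exprMn; apply: ler_pM; rewrite ?exprn_ge0 //.
  by rewrite ler_weXn2l // leq_addr.
by rewrite lerXn2r // nnegrE // (le_trans Y0).
Qed.

(** * Vanishing of the jet of a function with zeros accumulating along the curve *)

Section Core.
(** [D i j] stands for the derivative taken j times in y and then i times in x, the order in which
    [mpartial] differentiates. *)
Variables (R : realType) (D : nat -> nat -> R -> R -> R) (delta C r : R).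
Hypothesis delta0 : 0 < delta.
Hypothesis C0 : 0 <= C.
Hypothesis r1 : 1 <= r.
Hypothesis DX : forall i j (x : R), `|x| < delta ->
  is_derive x 1 (fun x => D i j x 0) (D i.+1 j x 0).
Hypothesis DY : forall j (x y : R), `|x| < delta -> `|y| < delta ->
  is_derive y 1 (D 0 j x) (D 0 j.+1 x y).
Hypothesis DB : forall i j (x y : R), `|x| < delta -> `|y| < delta ->
  `|D i j x y| <= C * r ^+ (i + j) * (i + j)`!%:R * loglog_seq R (i + j).

Lemma isO1_small (f : R -> R) : isO 1 f ->
  exists2 d, 0 < d & forall x, 0 < x < d -> `|f x| < delta /\ `|x| < delta.
Proof.
move=> [K [d [K0 d0 H]]]; exists (Num.min (Num.min d delta) (delta / (K + 1))).
  by rewrite !lt_min d0 delta0 divr_gt0 // ltr_wpDl.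
move=> x /andP[x0]; rewrite !lt_min => /andP[/andP[xd xe] xK].
split; last by rewrite gtr0_norm.
apply: le_lt_trans (H x _) _; first by rewrite x0.
rewrite expr1; move: xK; rewrite ltr_pdivlMr ?ltr_wpDl //; lra.
Qed.

(** Taylor's formula in y between two curves through the origin. It serves for passing from the axis
    to a curve, from the curve to the graph of a partial sum, and from the curve back to the
    axis. *)
Lemma taylor_isO j N e (a b : R -> R) : isO 1 a -> isO 1 b ->
  isO e (fun x => b x - a x) ->
  isO (e * N) (fun x => D 0 j x (b x) -
    \sum_(l < N) D 0 (j + l) x (a x) * ((b x - a x) ^+ l / l`!%:R)).
Proof.
move=> a1 b1 ab; have [d d0 Ha] := isO1_small a1; have [d' d0' Hb] := isO1_small b1.
pose B := C * r ^+ (0 + (j + N)) * (0 + (j + N))`!%:R * loglog_seq R (0 + (j + N)).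
apply: (@isO_le _ _ _ (fun x => B * (b x - a x) ^+ N) (Num.min d d')).
- by rewrite lt_min d0.
- move=> x /andP[x0]; rewrite lt_min => /andP[xd xd'].
  have [|ax xx] := Ha x; first by rewrite x0.
  have [|bx _] := Hb x; first by rewrite x0.
  have btw y : between (a x) (b x) y -> `|y| < delta.
    move=> h; rewrite -[y]subr0; apply: between_ball h; by rewrite subr0.
  have := @taylor R N (fun n => D 0 (j + n) x) (a x) (b x) B _ _.
  rewrite addn0 => h; apply: le_trans (h _ _) _.
  + by move=> n y /btw yd; rewrite addnS; apply: DY.
  + by move=> y /btw yd; apply: DB.
  by rewrite normrM normrX ler_wpM2r ?exprn_ge0 // ler_norm.
- exact: isOZ (isO_exp N ab).
Qed.

Definition jet_row N j : {poly R} := \poly_(i < N) (D i j 0 0 / i`!%:R).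

Lemma jet_row_expd N j : expd N (fun x => D 0 j x 0) (jet_row N j).
Proof.
pose B := C * r ^+ (N + j) * (N + j)`!%:R * loglog_seq R (N + j).
have d0 : `|0 : R| < delta by rewrite normr0.
exists B, delta; split=> //; first by apply: le_trans (DB N j d0 d0).
move=> x /andP[x0 xd].
have btw y : between 0 x y -> `|y| < delta.
  move=> h; rewrite -[y]subr0; apply: between_ball h; rewrite subr0 //.
  by rewrite gtr0_norm.
have := @taylor R N (fun n x => D n j x 0) 0 x B _ _.
rewrite subr0 (gtr0_norm x0) horner_poly => h.
rewrite (eq_bigr (fun i : 'I_N => D i j 0 0 * (x ^+ i / i`!%:R))); last first.
  by move=> i _; ring.
apply: h; first by move=> n y /btw yd; apply: DX.
by move=> y /btw yd; apply: DB.
Qed.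

(* D 0 j x y = sum_l D 0 (j + l) x 0 y^l / l!, truncated, with y replaced by p. *)
Definition jet_comp N j (p : {poly R}) : {poly R} :=
  \sum_(l < N) jet_row N (j + l) * (l`!%:R^-1 *: p ^+ l).

Lemma jet_comp_expd N j (h : R -> R) p : isO 1 h -> expd N h p ->
  expd N (fun x => D 0 j x (h x)) (jet_comp N j p).
Proof.
move=> h1 hp.
apply: (@expd_isO _ _ (fun x => \sum_(l < N) D 0 (j + l) x 0 * (l`!%:R^-1 * h x ^+ l))).
  apply: (@expd_sum _ _ _ (fun l x => D 0 (j + l) x 0 * (l`!%:R^-1 * h x ^+ l))
    (fun l => jet_row N (j + l) * (l`!%:R^-1 *: p ^+ l))) => l _.
  by apply: expdM; [exact: jet_row_expd|apply: expdZ; apply: expdX].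
have z1 : isO 1 (fun=> 0 : R) by exact: isO0.
have h1' : isO 1 (fun x => h x - 0) by apply: eq_isO h1 => x; rewrite subr0.
have := @taylor_isO j N 1 _ _ z1 h1 h1'; rewrite mul1n.
apply: eq_isO => x; congr (_ - _); apply: eq_bigr => l _.
by rewrite subr0; ring.
Qed.

(** The binomial coefficient of i + l is at most 2^(i + l), which turns (i + l)! into i! l!; the
    remaining factors increase with the order and are taken at [n]. *)
Lemma jet_coef_le i l n : (i + l <= n)%N ->
  `|D i l 0 0| / (i`!%:R * l`!%:R) <=
  C * (2 * r) ^+ n * (loglog R n / loglog R 0) ^+ (n + 3).
Proof.
move=> iln; have d0 : `|0 : R| < delta by rewrite normr0.
have f0 : 0 < i`!%:R * l`!%:R :> R by rewrite mulr_gt0 ?ltr0n ?fact_gt0.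
rewrite ler_pdivrMr //; apply: le_trans (DB i l d0 d0) _.
have hb : (i + l)`!%:R <= 2 ^+ n * (i`!%:R * l`!%:R) :> R.
  rewrite -natrX -!natrM ler_nat.
  have := @bin_fact (i + l) i (leq_addr _ _); rewrite addKn => <-.
  rewrite leq_mul2r; apply/orP; right.
  apply: leq_trans (leq_pexp2l _ iln) => //.
  rewrite -[(2 ^ _)%N]/((1 + 1) ^ (i + l))%N expnDn.
  have il : (i < (i + l).+1)%N by rewrite ltnS leq_addr.
  by rewrite (bigD1 (Ordinal il)) //= !exp1n !muln1 leq_addr.
have hr : r ^+ (i + l) <= r ^+ n by rewrite ler_weXn2l.
have hM : loglog_seq R (i + l) <= (loglog R n / loglog R 0) ^+ (n + 3).
  apply: le_trans (loglog_seq_le R (i + l)) _.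
  apply: (@le_trans _ _ ((loglog R n / loglog R 0) ^+ (i + l + 3))).
    rewrite lerXn2r ?nnegrE ?divr_ge0 ?(ltW (loglog_gt0 _ _)) //.
    by rewrite ler_pM2r ?invr_gt0 ?loglog_gt0 // loglog_homo.
  by rewrite ler_weXn2l ?wt_base_ge1 // leq_add2r.
have -> : C * (2 * r) ^+ n * (loglog R n / loglog R 0) ^+ (n + 3) * (i`!%:R * l`!%:R)
  = C * r ^+ n * (2 ^+ n * (i`!%:R * l`!%:R)) * (loglog R n / loglog R 0) ^+ (n + 3).
  by rewrite exprMn; ring.
have r0 : 0 <= r := le_trans ler01 r1.
apply: ler_pM => //; [|exact: ltW (loglog_seq_gt0 _ _)|].
  by rewrite mulr_ge0 // mulr_ge0 // exprn_ge0.
apply: ler_pM => //; first by rewrite mulr_ge0 // exprn_ge0.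
exact: ler_wpM2l.
Qed.

(** At most (n + 1)^2 products contribute. Each is a jet coefficient times a coefficient of a power
    of [p], and [coefleX] bounds the latter uniformly in the power; powers above the available
    degree contribute 0. *)
Lemma jet_comp_coef_le n (p : {poly R}) (B : R) :
  p`_0 = 0 -> coefle p 1 B -> 1 <= B ->
  `|(jet_comp n.+1 0 p)`_n| <= n.+1%:R ^+ 2 *
    (C * (2 * r) ^+ n * (loglog R n / loglog R 0) ^+ (n + 3) * (2 * B) ^+ n).
Proof.
move=> p0 pB B1; set K := C * _ * _ * _.
have K0 : 0 <= K.
  have a0 : 0 <= 2 * r by rewrite mulr_ge0 // (le_trans ler01).
  have b0 : 0 <= loglog R n / loglog R 0 by rewrite divr_ge0 // ltW ?loglog_gt0.
  have c0 : 0 <= 2 * B by rewrite mulr_ge0 // (le_trans ler01).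
  by rewrite /K !mulr_ge0 ?exprn_ge0.
have P := coefleX _ p0 pB (le_trans ler01 B1).
rewrite /jet_comp coef_sum; apply: le_trans (ler_norm_sum _ _ _) _.
apply: (@le_trans _ _ (\sum_(l < n.+1) n.+1%:R * K)); last first.
  by rewrite sumr_const card_ord -[leLHS]mulr_natl expr2 mulrA.
apply: ler_sum => l _; rewrite coefM; apply: le_trans (ler_norm_sum _ _ _) _.
apply: (@le_trans _ _ (\sum_(i < n.+1) K)); last first.
  by rewrite sumr_const card_ord mulr_natl.
apply: ler_sum => i _; rewrite coef_poly ltn_ord coefZ add0n.
case: (leqP l (n - i)) => [lni|lni]; last first.
  by rewrite coef_exp_eq0 // !mulr0 normr0.
have iln : (i + l <= n)%N by have := ltn_ord i; lia.
have -> : D i l 0 0 / i`!%:R * (l`!%:R^-1 * (p ^+ l)`_(n - i)) =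
  (D i l 0 0 / (i`!%:R * l`!%:R)) * (p ^+ l)`_(n - i) by rewrite invfM; ring.
rewrite normrM /K; apply: ler_pM => //.
  apply: le_trans (jet_coef_le iln); rewrite normrM ler_wpM2l //.
  by rewrite ger0_norm // invr_ge0 mulr_ge0.
apply: le_trans (P l (n - i)%N) _; rewrite mul1r ler_weXn2l ?leq_subr //.
by rewrite -[leLHS]mulr1; apply: ler_pM => //; rewrite ler1n.
Qed.

Hypothesis zeros : forall d, 0 < d -> exists x, 0 < x < d /\ D 0 0 x (osq x) = 0.

(** Along the curve there is an expansion of every order. At the zeros its polynomial equals the
    remainder up to sign, hence is small at arbitrarily small points, and its coefficients
    vanish. *)
Lemma flat_at_zeros N : isO N (fun x => D 0 0 x (osq x)).
Proof.
have [p hp] := osq_expd R N; have := jet_comp_expd 0 (osq_isO R) hp.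
set P := jet_comp _ _ _ => H; apply/expd0; apply: expd_coef H => i iN.
have [K [d [K0 d0 HK]]] := jet_comp_expd 0 (osq_isO R) hp.
rewrite coef0; apply: (@coef_eq0_of_small R N P K) iN => e e0.
have [|x [/andP[x0]]] := zeros (_ : 0 < Num.min d e); first by rewrite lt_min d0.
rewrite lt_min => /andP[xd xe] Dx; exists x; rewrite x0 xe; split=> //.
by have := HK x; rewrite x0 xd => /(_ isT); rewrite Dx sub0r normrN.
Qed.

(* If G_j is the first coefficient along the curve which is not flat, then
   replacing osq by its k-th partial sum changes D 0 0 by a leading term which
   is too large for the Taylor coefficients of D 0 0 at the origin. *)
Lemma flat_along_curve j N : isO N (fun x => D 0 j x (osq x)).
Proof.
elim/ltn_ind: j N => j IH.
case: (posnP j) => [->|j0]; first exact: flat_at_zeros.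
apply: contrapT => /existsNP[N nf].
have [p hp] := osq_expd R N.
have [d [u [u0 ud]]] := expd_lead (jet_comp_expd j (osq_isO R) hp) nf.
have l0 := loglog_gt0 R 0; have l1 := loglog0_le1 R.
have [||||k [kj]] := @freq_beats R `|u| (C * j`!%:R) (1024 * r / loglog R 0) j d.
- by rewrite normr_gt0.
- by rewrite mulr_ge0.
- by rewrite ler_pdivlMr // mul1r; have := r1; lra.
- exact: j0.
have qk : (k.+1 < qseq R k.+1)%N := qseq_gt R k.+1.
have rl := osq_remainder_lead R k.+1.
have pk0 := coef0_osq_poly R k.+1; have pkle := osq_poly_coefle R k.
have pkE := partial_osq_expd R k.+1; have pkO := partial_osq_isO R k.+1.
have f9 := freq_ge9 R k; have F9 := freq_ge9 R k.+1.
have Lq : forall n, (n + 3 <= (qseq R k.+1 + 3) ^ 2)%N -> loglog R n <= 1 + freq R k.+1.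
  by move=> n; apply: loglog_sqr.
have ampE : amp R k.+1 = (2 ^+ k.+1 * freq R k.+1 ^+ (2 * qseq R k.+1))^-1 by [].
move: (amp R k.+1) (qseq R k.+1) (freq R k) (freq R k.+1) (partial_osq k.+1)
  (osq_poly R k.+1) ampE qk rl pk0 pkle pkE pkO f9 F9 Lq
  => a q f F Pk pk aE qk rl pk0 pkle pkE pkO f9 F9 Lq.
have F0 : 0 < F by lra.
(* The term of order j in Taylor's formula from the curve to the partial sum starts with u x^d (- A
   x^(4 q))^j / j!, of degree [n]. *)
pose n := (d + 4 * q * j)%N; pose A := a * F ^+ (8 * q).
have jdq : (4 * j + d + 3 < q)%N by apply: leq_ltn_trans kj (ltnW qk).
have dq : (d < 4 * q)%N by clear -jdq; lia.
have Pl : lead (4 * q) (- A) (fun x => Pk x - osq x).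
  by apply: eq_isO (leadZ (-1) rl) => x; rewrite /A; ring.
pose c := u * (j`!%:R^-1 * (- A) ^+ j).
(* Terms of order l < j are flat by induction, and the remainder has order 4 q (j + 1) > n because d
   < 4 q; only l = j contributes. *)
have Dl : lead n c (fun x => D 0 0 x (Pk x)).
  have T := taylor_isO 0 j.+1 (osq_isO R) pkO (lead_isO Pl).
  have {}T := isO_widen (_ : (n.+1 <= 4 * q * j.+1)%N) T.
  have nq : (n.+1 <= 4 * q * j.+1)%N by rewrite mulnS /n -addSn leq_add2r.
  have {}T := T nq.
  have S : isO n.+1 (fun x => \sum_(l < j) D 0 (0 + l) x (osq x) *
      ((Pk x - osq x) ^+ l / l`!%:R)).
    apply: (@isO_sum _ _ _ (fun l x => D 0 (0 + l) x (osq x) *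
      ((Pk x - osq x) ^+ l / l`!%:R))) => l lj.
    have h := isO_exp l (isO_widen (leq0n _) (lead_isO Pl)).
    have := isOM (IH l lj n.+1) (isOZ (l`!%:R^-1) h); rewrite mul0n addn0.
    by apply: eq_isO => x; rewrite add0n; ring.
  have M := leadM ud (leadZ (j`!%:R^-1) (leadX j Pl)).
  apply: eq_isO (isOD (isOD T S) M) => x.
  rewrite big_ord_recr /= -/c add0n -/n.
  by move: (\sum_(i < j) _) => s; ring.
(* The same coefficient computed from the jet at the origin: the partial sum has expansions with
   controlled coefficients, and expansions are unique. *)
have cE : (jet_comp n.+1 0 (pk n.+1))`_n = c.
  have E1 := jet_comp_expd 0 pkO (pkE n.+1).
  have E2 : expd n.+1 (fun x => D 0 0 x (Pk x)) (c *: 'X^n).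
    by apply: eq_isO Dl => x; rewrite hornerZ hornerXn.
  by rewrite (expd_uniq E1 E2 (leqnn _)) coefZ coefXn eqxx mulr1.
have B1 : 1 <= 16 * f ^+ 2.
  by rewrite -[leLHS]mulr1; apply: ler_pM => //; [lra|apply: exprn_ege1; lra].
have := @jet_comp_coef_le n _ _ (pk0 n.+1) (pkle n.+1) B1; rewrite cE.
have AE : A = F ^+ (6 * q) / 2 ^+ k.+1.
  have -> : A = a * (F ^+ (6 * q) * F ^+ (2 * q)).
    by rewrite /A -exprD; congr (_ * _ ^+ _); clear; lia.
  rewrite aE invfM mulrCA -mulrA mulVf ?mulr1 // expf_neq0 //.
  by rewrite gt_eqF.
have jf0 : 0 < j`!%:R :> R by rewrite ltr0n fact_gt0.
have cN : `|u| * F ^+ (6 * (q * j)) = 2 ^+ (k.+1 * j) * `|c| * j`!%:R.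
  rewrite /c normrM normrM normfV normrX normrN (gtr0_norm jf0) AE.
  have p0 : 0 < F ^+ (6 * q) / 2 ^+ k.+1 by rewrite divr_gt0 ?exprn_gt0.
  rewrite (gtr0_norm p0) expr_div_n -!exprM mulnA.
  have p2 : 2 ^+ (k.+1 * j) != 0 :> R by rewrite expf_neq0.
  move: (F ^+ (6 * q * j)) (2 ^+ (k.+1 * j)) (`|u|) (j`!%:R) jf0 p2 => X Y Z W W0 Y0.
  by field; rewrite Y0 gt_eqF.
move=> cle; rewrite ltNge => /negP; apply; rewrite cN [leRHS]mulrAC.
apply: ler_wpM2r; first exact: ltW.
have qj : (q <= q * j)%N by clear -j0; rewrite leq_pmulr.
have n1 : (k.+1 * j <= n)%N.
  apply: leq_trans (leq_addl _ _); rewrite leq_mul2r; apply/orP; right.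
  by apply: leq_trans (ltnW qk) _; rewrite leq_pmull.
have n2 : (n + 3 <= 5 * (q * j))%N.
  rewrite /n -mulnA; move: (q * j)%N qj => m qm; clear -jdq qm; lia.
(* Since 4 j + d + 3 < q, the order n is at most about q^2, so that L n <= 1 + F by [loglog_sqr]. *)
have n3 : (n + 3 <= (q + 3) ^ 2)%N.
  apply: (@leq_trans (q * q)); last first.
    by rewrite (_ : (q + 3) ^ 2 = (q + 3) * (q + 3))%N // leq_mul ?leq_addr.
  apply: (@leq_trans (q * (4 * j + d + 3))); last by rewrite leq_mul2l ltnW ?orbT.
  rewrite /n -addnA mulnDr mulnDr -!addnA mulnCA mulnA addnCA leq_add2l.
  by rewrite leq_add // leq_pmull //; clear -jdq; lia.
apply: le_trans (coef_bound_collect C0 r1 _ _ _ _ n1 n2).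
- by apply: ler_wpM2l cle; rewrite exprn_ge0.
- by rewrite l0.
- by apply: le_trans f9; rewrite ler1n.
- by apply: le_trans F9; rewrite ler1n.
- have Ln := Lq n n3; have Ln0 := loglog_gt0 R n.
  rewrite ltW //=; apply: le_trans Ln _; rewrite mulr_natl mulr2n lerD2r.
  by apply: le_trans F9; rewrite ler1n.
Qed.

(** All y-derivatives being flat along the curve, Taylor's formula from the curve to the axis makes
    each [D 0 j x 0] flat, and its expansion coefficients are D i j 0 0 / i!. *)
Theorem jets_vanish i j : D i j 0 0 = 0.
Proof.
have z1 : isO 1 (fun=> 0 : R) by exact: isO0.
have h : isO 1 (fun x : R => 0 - osq x).
  by apply: (eq_isO _ (isOZ (-1) (osq_isO R))) => x; ring.
have T := taylor_isO j i.+1 (osq_isO R) z1 h; rewrite mul1n in T.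
have S : isO i.+1 (fun x : R => \sum_(l < i.+1) D 0 (j + l) x (osq x) *
    ((0 - osq x) ^+ l / l`!%:R)).
  apply: (@isO_sum _ _ _ (fun l x => D 0 (j + l) x (osq x) *
    ((0 - osq x) ^+ l / l`!%:R))) => l _.
  have e := isO_exp l (isO_widen (leq0n _) h).
  have := isOM (flat_along_curve (j + l) i.+1) (isOZ (l`!%:R^-1) e).
  by rewrite mul0n addn0; apply: eq_isO => x; ring.
have F : isO i.+1 (fun x : R => D 0 j x 0).
  apply: eq_isO (isOD T S) => x.
  by move: (\sum_(l < i.+1) _) => s; ring.
have := expd_uniq (jet_row_expd i.+1 j) ((expd0 _ _).2 F) (leqnn _).
rewrite coef_poly leqnn coef0 => /eqP; rewrite mulf_eq0 invr_eq0 pnatr_eq0.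
by rewrite (gtn_eqF (fact_gt0 i)) orbF => /eqP.
Qed.

End Core.

(** * Stability of the Denjoy-Carleman class *)

Section MultiJets.
Variables (R : realType) (m : nat).
Implicit Types (E F : seq 'I_m -> 'rV[R]_m -> R) (l : seq 'I_m) (x : 'rV[R]_m).

(* E [:: i1; ...; ik] stands for the partial derivative of E [::] along i1, then i2,
   and so on; orders of differentiation are never exchanged. *)
Definition mjet E := forall l x, {for x, continuous (E l)} /\
  forall i, is_derive x (delta_mx 0 i) (E l) (E (rcons l i) x).

Lemma mjet_partial E l i : mjet E -> partial i (E l) = E (rcons l i).
Proof. by move=> jE; apply/funext => x; have [_ /(_ i)[_ ]] := jE l x. Qed.

Lemma mjet_smooth E U : mjet E -> smooth_on U (E [::]).
Proof.
move=> jE k; elim: k [::] => [|k IH] l /=; split=> //.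
- by move=> x _; case: (jE l x).
- by move=> x _; case: (jE l x).
- move=> i; rewrite mjet_partial //; split=> // x _.
  by have [_ /(_ i)[]] := jE l x.
Qed.

Lemma mjet_mpartial E alpha : mjet E ->
  exists2 l, mpartial alpha (E [::]) = E l & size l = mdeg alpha.
Proof.
move=> jE; rewrite /mpartial /mdeg.
rewrite (_ : (\sum_(i < m) alpha i = \sum_(i <- enum 'I_m) alpha i)%N);
  last by rewrite big_enum.
elim: (enum _) => [|i s [l El sl]] /=; first by exists [::] => //; rewrite big_nil.
rewrite big_cons El.
have [l' El' sl'] : exists2 l', iter (alpha i) (partial i) (E l) = E l' &
    size l' = (alpha i + size l)%N.
  elim: (alpha i) => [|n [l' El' sl']]; first by exists l.
  by exists (rcons l' i); rewrite ?size_rcons ?sl' //= El' mjet_partial.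
by exists l' => //; rewrite sl' sl.
Qed.

Fixpoint mulj l E F : 'rV[R]_m -> R :=
  if l is i :: l' then
    fun x => mulj l' (fun k => E (i :: k)) F x + mulj l' E (fun k => F (i :: k)) x
  else fun x => E [::] x * F [::] x.

Lemma mulj_mjet E F : mjet E -> mjet F -> mjet (fun l => mulj l E F).
Proof.
move=> + + l; elim: l E F => [|i l IH] E F jE jF x.
  have [cE dE] := jE [::] x; have [cF dF] := jF [::] x.
  split; first exact: (cvgM cE cF).
  move=> i; have := @is_deriveM _ _ (E [::]) (F [::]) x _ _ _ (dE i) (dF i).
  rewrite [X in is_derive _ _ _ X -> _](_ : _ = mulj [:: i] E F x) //=.
  by rewrite /GRing.scale /= addrC; congr (_ + _); rewrite mulrC.
have [c1 d1] := IH _ _ (fun k y => jE (i :: k) y) jF x.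
have [c2 d2] := IH _ _ jE (fun k y => jF (i :: k) y) x.
split; first exact: (cvgD c1 c2).
by move=> j; apply: (is_deriveD (d1 j) (d2 j)).
Qed.

Definition weight n : R := n`!%:R * wt R n.

Lemma weight_gt0 n : 0 < weight n.
Proof. by rewrite mulr_gt0 ?wt_gt0 // ltr0n fact_gt0. Qed.

Lemma weightD a b : weight a * weight b <= weight (a + b).
Proof.
rewrite /weight mulrACA; apply: ler_pM; rewrite ?mulr_ge0 ?(ltW (wt_gt0 _ _)) //.
  rewrite -natrM ler_nat -(bin_fact (leq_addr b a)) addKn.
  by rewrite leq_pmull // bin_gt0 leq_addr.
exact: wtD.
Qed.

(** The offsets [a] and [b] let the induction replace a factor by one of its derivatives; [weightD]
    recombines the weights at the end. *)
Lemma mulj_le E F (W : set 'rV[R]_m) (A B r : R) a b : 0 <= A -> 0 <= B -> 0 <= r ->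
  (forall l x, W x -> `|E l x| <= A * r ^+ size l * weight (size l + a)) ->
  (forall l x, W x -> `|F l x| <= B * r ^+ size l * weight (size l + b)) ->
  forall l x, W x ->
  `|mulj l E F x| <= A * B * (2 * r) ^+ size l * weight (size l + (a + b)).
Proof.
move=> + + r0 + + l; elim: l E F A B a b => [|i l IH] E F A B a b A0 B0 EA FB x Wx /=.
  have := EA [::] x Wx; have := FB [::] x Wx; rewrite /= !expr0 !mulr1 !add0n normrM => h1 h2.
  apply: le_trans (ler_pM _ _ h2 h1) _ => //.
  by rewrite mulrACA; apply: ler_wpM2l (weightD a b); apply: mulr_ge0.
have h1 : `|mulj l (fun k => E (i :: k)) F x| <=
    A * r * B * (2 * r) ^+ size l * weight (size l + (a.+1 + b)).
  apply: IH => //; first exact: mulr_ge0.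
  by move=> k y Wy; apply: le_trans (EA _ _ Wy) _; rewrite /= exprS mulrA addSnnS.
have h2 : `|mulj l E (fun k => F (i :: k)) x| <=
    A * (B * r) * (2 * r) ^+ size l * weight (size l + (a + b.+1)).
  apply: IH => //; first exact: mulr_ge0.
  by move=> k y Wy; apply: le_trans (FB _ _ Wy) _; rewrite /= exprS mulrA addSnnS.
apply: le_trans (ler_normD _ _) _; apply: le_trans (lerD h1 h2) _.
rewrite !addSn !addnS exprS le_eqVlt; apply/orP; left; apply/eqP; ring.
Qed.

Definition jet_bounded E := forall a : 'rV[R]_m, exists A r : R,
  [/\ 0 <= A, 1 <= r & forall l x, box a 1 x ->
    `|E l x| <= A * r ^+ size l * weight (size l)].

(** A working class of functions on the whole space, with [wt] as weight. It is stable under sums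
    and products, which suffices to build the equations of the lifted curve. *)
Definition dc (f : 'rV[R]_m -> R) :=
  exists E, [/\ mjet E, jet_bounded E & E [::] = f].

Lemma bound_widen (A B r s : R) n : 0 <= A <= B -> 1 <= r <= s ->
  A * r ^+ n * weight n <= B * s ^+ n * weight n.
Proof.
move=> /andP[A0 AB] /andP[r1 rs]; have r0 : 0 <= r by lra.
apply: ler_wpM2r; first exact: ltW (weight_gt0 n).
apply: ler_pM => //; first exact: exprn_ge0.
by rewrite lerXn2r // nnegrE; lra.
Qed.

Lemma dcM f g : dc f -> dc g -> dc (fun x => f x * g x).
Proof.
move=> [E [jE bE <-]] [F [jF bF <-]]; exists (fun l => mulj l E F); split=> //.
  exact: mulj_mjet.
move=> a; have [A [r [A0 r1 EA]]] := bE a; have [B [s [B0 s1 FB]]] := bF a.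
have rm : r <= Num.max r s by rewrite le_max lexx.
have sm : s <= Num.max r s by rewrite le_max lexx orbT.
exists (A * B), (2 * Num.max r s); split; first exact: mulr_ge0; first by lra.
move=> l x bx; have := @mulj_le E F (box a 1) A B (Num.max r s) 0 0 A0 B0 _ _ _ l x bx.
rewrite !addn0; apply; first by lra.
  move=> k y yb; rewrite addn0; apply: le_trans (EA k y yb) (bound_widen _ _ _).
    by rewrite A0 lexx.
  by rewrite r1.
move=> k y yb; rewrite addn0; apply: le_trans (FB k y yb) (bound_widen _ _ _).
  by rewrite B0 lexx.
by rewrite s1.
Qed.

Lemma dcD f g : dc f -> dc g -> dc (fun x => f x + g x).
Proof.
move=> [E [jE bE <-]] [F [jF bF <-]]; exists (fun l x => E l x + F l x); split=> //.
  move=> l x; have [cE dE] := jE l x; have [cF dF] := jF l x.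
  split; first exact: (cvgD cE cF).
  by move=> i; apply: (is_deriveD (dE i) (dF i)).
move=> a; have [A [r [A0 r1 EA]]] := bE a; have [B [s [B0 s1 FB]]] := bF a.
have rm : r <= Num.max r s by rewrite le_max lexx.
have sm : s <= Num.max r s by rewrite le_max lexx orbT.
exists (A + B), (Num.max r s); split; first exact: addr_ge0; first by lra.
move=> l x bx; apply: le_trans (ler_normD _ _) _; rewrite !mulrDl.
apply: lerD.
  by apply: le_trans (EA l x bx) (bound_widen _ _ _); rewrite ?A0 ?lexx ?r1.
by apply: le_trans (FB l x bx) (bound_widen _ _ _); rewrite ?B0 ?lexx ?s1.
Qed.

Definition coord_jet i0 (h : nat -> R -> R) l x : R :=
  if all (pred1 i0) l then h (size l) (x 0 i0) else 0.

Lemma coord_jet_mjet i0 h : chain h -> mjet (coord_jet i0 h).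
Proof.
move=> ch l x; rewrite /coord_jet; split.
  case: (all _ l) => /=; last exact: cst_continuous.
  apply: (@continuous_comp _ _ _ (fun y : 'rV[R]_m => y 0 i0) (h (size l))).
    exact: coord_continuous.
  by apply/differentiable_continuous/derivable1_diffP; case: (ch (size l) (x 0 i0)).
move=> i; rewrite all_rcons size_rcons; case: (all _ l); last first.
  by rewrite andbF; apply: is_derive_cst.
rewrite andbT /=; case: eqP => [->|/eqP ni].
  have [dh hE] := ch (size l) (x 0 i0).
  have E : (fun t : R => t^-1 *: (((fun y : 'rV[R]_m => h (size l) (y 0 i0)) \o shift x)
       (t *: delta_mx 0 i0) - h (size l) (x 0 i0)))
    = (fun t : R => t^-1 *: ((h (size l) \o shift (x 0 i0)) (t *: 1) - h (size l) (x 0 i0))).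
    by apply/funext => t /=; rewrite !mxE !eqxx.
  by apply: DeriveDef; rewrite /derivable /derive E.
have E : (fun t : R => t^-1 *: (((fun y : 'rV[R]_m => h (size l) (y 0 i0)) \o shift x)
     (t *: delta_mx 0 i) - h (size l) (x 0 i0))) = cst 0.
  apply/funext => t /=; rewrite !mxE eqxx /= eq_sym (negbTE ni) mulr0 add0r subrr.
  exact: scaler0.
apply: DeriveDef; rewrite /derivable /derive E; first exact: is_cvg_cst.
by apply: cvg_lim => //; apply: cvg_cst.
Qed.

Lemma dc_coord i0 h : chain h ->
  (forall a, exists A r : R, [/\ 0 <= A, 1 <= r & forall n t, `|t - a| < 1 ->
     `|h n t| <= A * r ^+ n * weight n]) ->
  dc (fun x => h 0 (x 0 i0)).
Proof.
move=> ch bh; exists (coord_jet i0 h); split=> //; first exact: coord_jet_mjet.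
move=> a; have [A [r [A0 r1 H]]] := bh (a 0 i0); exists A, r; split=> // l x bx.
rewrite /coord_jet; case: ifP => _; first by apply: H; apply: bx.
rewrite normr0 mulr_ge0 ?(ltW (weight_gt0 _)) // mulr_ge0 // exprn_ge0 //; lra.
Qed.

Lemma weight_ge1 n : 1 <= weight n.
Proof.
by rewrite /weight -[leLHS]mulr1; apply: ler_pM; rewrite ?wt_ge1 // ler1n fact_gt0.
Qed.

Lemma dc_cst c : dc (fun=> c).
Proof.
exists (fun l x => if l is [::] then c else 0); split=> //.
  move=> [|j l] x; (split; first exact: cst_continuous) => i; exact: is_derive_cst.
move=> a; exists `|c|, 1; split=> // -[|j l] x _.
  by rewrite /= expr0 mulr1 ler_peMr // weight_ge1.
by rewrite normr0 expr1n mulr1 mulr_ge0 // ltW ?weight_gt0.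
Qed.

Definition idc n (x : R) : R := match n with 0 => x | 1 => 1 | _ => 0 end.

Lemma idc_chain : chain idc.
Proof.
by move=> [|[|n]] x; [apply: is_derive_id|apply: is_derive_cst|apply: is_derive_cst].
Qed.

Lemma dc_proj i0 : dc (fun x => x 0 i0).
Proof.
apply: (dc_coord i0 idc_chain) => a; exists (`|a| + 1), 1; split=> // n t ta.
rewrite expr1n mulr1.
apply: (@le_trans _ _ (`|a| + 1)); last by rewrite ler_peMr ?weight_ge1 // addr_ge0.
case: n => [|[|n]] /=; rewrite ?normr0 ?normr1 ?addr_ge0 ?lerDr //.
rewrite -[t](subrK a) addrC (le_trans (ler_normD _ _)) // lerD2l; exact: ltW.
Qed.

Lemma dcN f : dc f -> dc (fun x => - f x).
Proof.
move=> /(dcM (dc_cst (-1))); congr dc; apply/funext => x; exact: mulN1r.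
Qed.

Lemma dc_osc i0 : dc (fun x => osc 0 (x 0 i0)).
Proof.
apply: (dc_coord i0 (@osc_chain R)) => a; exists 2, (expR 8); split=> //.
  by have := expR_ge1Dx (8 : R); lra.
by move=> n t _; apply: le_trans (osc_le n t) _; rewrite /oscb /weight !mulrA.
Qed.

Lemma dc_denjoy_carleman f : dc f -> denjoy_carleman (loglog_seq R) setT f.
Proof.
move=> [E [jE bE <-]]; split; first exact: mjet_smooth.
move=> a _; have [A [r [A0 r1 EA]]] := bE a; exists (box a 1); split=> //.
  by apply/nbhs_boxP; exists 1.
have l0 := loglog_gt0 R 0.
(* [A] may be 0, whereas a positive constant is required; dividing [r] by [loglog R 0] pays for the
   passage from [wt] to [loglog_seq]. *)
exists (A + 1), (r / loglog R 0); split.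
- by rewrite ltr_wpDl.
- by rewrite divr_gt0 //; lra.
move=> alpha x bx; have [l -> <-] := mjet_mpartial alpha jE.
apply: le_trans (EA l x bx) _; rewrite /weight exprMn.
have rn : 0 <= r ^+ size l by rewrite exprn_ge0 //; lra.
have w := wt_le_loglog_seq R (size l); have w0 := wt_gt0 R (size l).
have -> : (A + 1) * (r ^+ size l * (loglog R 0)^-1 ^+ size l) * (size l)`!%:R *
   loglog_seq R (size l) = (A + 1) * r ^+ size l * ((size l)`!%:R *
   ((loglog R 0)^-1 ^+ size l * loglog_seq R (size l))) by ring.
apply: ler_pM => //.
- exact: mulr_ge0.
- by rewrite mulr_ge0 // ltW.
- by apply: ler_wpM2r => //; lra.
- exact: ler_wpM2l.
Qed.

End MultiJets.

(** * The curve *)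

Section Curve.
Variable R : realType.

Definition osc_curve : set 'rV[R]_2 := [set u | exists t,
  [/\ t ^+ 2 < 1, u 0 ord0 = t ^+ 2 & u 0 ord_max = osc 0 t]].

Definition pt (x y : R) : 'rV[R]_2 := \row_j (if j == ord0 then x else y).

Lemma ord2P (j : 'I_2) : j = ord0 \/ j = ord_max.
Proof. by case: j => -[|[|//]] h; [left|right]; apply/val_inj. Qed.

Lemma ptx x y : pt x y 0 ord0 = x. Proof. by rewrite mxE. Qed.
Lemma pty x y : pt x y 0 ord_max = y. Proof. by rewrite mxE. Qed.

Lemma pt0 : pt 0 0 = 0.
Proof. by apply/rowP => j; rewrite !mxE; case: ifP. Qed.

Lemma upd_pt0 x y s : upd (pt x y) ord0 s = pt s y.
Proof. by apply/rowP => j; rewrite !mxE; case: (j == ord0). Qed.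

Lemma upd_pt1 x y s : upd (pt x y) ord_max s = pt x s.
Proof. by apply/rowP => j; rewrite !mxE; case: (ord2P j) => ->. Qed.

Lemma box_pt x y e : box (0 : 'rV[R]_2) e (pt x y) <-> `|x| < e /\ `|y| < e.
Proof.
split=> [b|[xe ye] j].
  have := b ord0; have := b ord_max.
  by rewrite ptx pty !mxE !subr0.
by case: (ord2P j) => ->; rewrite ?ptx ?pty mxE subr0.
Qed.

Lemma osc_curve_graph u : osc_curve u -> u 0 ord_max = osq (u 0 ord0).
Proof.
move=> [t [_ -> ->]]; rewrite /osq sqrtr_sqr.
by case: (leP 0 t) => ht; [rewrite ger0_norm|rewrite ltr0_norm ?osc_even].
Qed.

Lemma osc_curve_pt x : 0 < x < 1 -> osc_curve (pt x (osq x)).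
Proof.
move=> /andP[x0 x1]; exists (Num.sqrt x).
by rewrite ptx pty sqr_sqrtr // ltW.
Qed.

(** The set lies on a graph over the first coordinate, so it contains no vertical segment. *)
Lemma osc_curve_interior (u : 'rV[R]_2) (V : set 'rV[R]_2) : nbhs u V -> V `<=` osc_curve -> False.
Proof.
move=> /nbhs_boxP[e e0 eV] VA.
have h y : `|y - u 0 ord_max| < e -> y = osq (u 0 ord0).
  move=> ye; have : box u e (upd u ord_max y).
    move=> j; rewrite mxE; case: eqP => [->//|_]; by rewrite subrr normr0.
  move=> /eV/VA/osc_curve_graph; rewrite !mxE eqxx.
  by rewrite (_ : ord0 == ord_max = false).
have h1 := h (u 0 ord_max); have h2 := h (u 0 ord_max + e / 2).
rewrite subrr normr0 in h1; rewrite addrC addKr in h2.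
have e2 : 0 < e / 2 by rewrite divr_gt0.
have /h2 E : `|e / 2| < e by rewrite gtr0_norm //; lra.
by have := h1 e0; lra.
Qed.

(** For p = 2 no index satisfies p <= i: the local equations of the submanifold are void, and it
    would contain an open set. *)
Lemma dim_osc_curve : dim_le osc_curve 1.
Proof.
move=> p N [a Na] NA [p2 H]; rewrite leqNgt; apply/negP => p1.
have [V [V' [F [G [[Vo Va _] [_ _ _ _ VN]]]]]] := H a Na.
apply: (@osc_curve_interior a V); first exact: open_nbhs_nbhs.
move=> x Vx; apply/NA/VN => // i pi.
by have := ltn_ord i; rewrite ltnNge (leq_trans p1 pi).
Qed.

(** A basic set has a single equation, so x = t^2 and y = f t are combined as a sum of squares,
    written with the operations under which [dc] is stable. *)
Definition lift_eq (v : 'rV[R]_(2 + 1)) : R :=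
  (v 0 (lshift 1 ord0) + - (v 0 (rshift 2 ord0) * v 0 (rshift 2 ord0))) *
  (v 0 (lshift 1 ord0) + - (v 0 (rshift 2 ord0) * v 0 (rshift 2 ord0))) +
  (v 0 (lshift 1 ord_max) + - osc 0 (v 0 (rshift 2 ord0))) *
  (v 0 (lshift 1 ord_max) + - osc 0 (v 0 (rshift 2 ord0))).

Definition lift_ineq (v : 'rV[R]_(2 + 1)) : R :=
  1 + - (v 0 (rshift 2 ord0) * v 0 (rshift 2 ord0)).

Lemma dc_lift_eq : dc lift_eq.
Proof.
have dx := dcD (dc_proj R (lshift 1 (ord0 : 'I_2)))
  (dcN (dcM (dc_proj R (rshift 2 (ord0 : 'I_1))) (dc_proj R (rshift 2 (ord0 : 'I_1))))).
have dy := dcD (dc_proj R (lshift 1 (ord_max : 'I_2)))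
  (dcN (dc_osc R (rshift 2 (ord0 : 'I_1)))).
exact: dcD (dcM dx dx) (dcM dy dy).
Qed.

Lemma dc_lift_ineq : dc lift_ineq.
Proof.
exact: dcD (dc_cst _ 1)
  (dcN (dcM (dc_proj R (rshift 2 (ord0 : 'I_1))) (dc_proj R (rshift 2 (ord0 : 'I_1))))).
Qed.

Lemma lift_eqP v : lift_eq v = 0 <->
  v 0 (lshift 1 ord0) = v 0 (rshift 2 ord0) ^+ 2 /\
  v 0 (lshift 1 ord_max) = osc 0 (v 0 (rshift 2 ord0)).
Proof.
rewrite /lift_eq -!expr2; split=> [/eqP|[-> ->]]; last by rewrite !subrr expr0n /= addr0.
by rewrite paddr_eq0 ?sqr_ge0 // !sqrf_eq0 !subr_eq0 => /andP[/eqP -> /eqP ->].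
Qed.

Lemma subanalytic_osc_curve : subanalytic (loglog_seq R) osc_curve.
Proof.
move=> a; exists setT; split; first exact: filterT.
exists 1%N, [set v | lift_eq v = 0 /\ 0 < lift_ineq v]; split.
- exists (1 + 2 * oscb R 0); split; first exact: num_real.
  move=> M cM v [/lift_eqP[vx vy]]; rewrite /lift_ineq -expr2 => vt.
  apply: le_trans (ltW cM).
  have o0 : 0 <= 2 * oscb R 0 by apply: le_trans (osc_le 0 0).
  rewrite [leLHS]/Num.Def.normr/= mx_normrE bigmax_le ?addr_ge0 // => -[i j] _ /=.
  have t1 : v 0 (rshift 2 ord0) ^+ 2 <= 1 by lra.
  rewrite (ord1 i); case: (split_ordP j) => k ->.
    case: (ord2P k) => ->; first by rewrite vx ger0_norm ?sqr_ge0 //; lra.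
    by rewrite vy; have := osc_le 0 (v 0 (rshift 2 ord0)); lra.
  rewrite (ord1 k); apply: (@le_trans _ _ 1); last by rewrite lerDl.
  by rewrite -(@expr_le1 _ 2) // real_normK // num_real.
- move=> b; exists setT; split=> //; first exact: openT.
  exists 1%N, (fun=> [set v | lift_eq v = 0 /\ 0 < lift_ineq v]); split.
    move=> _; exists lift_eq, 1%N, (fun=> lift_ineq); split.
    + exact: dc_denjoy_carleman dc_lift_eq.
    + by move=> _; exact: dc_denjoy_carleman dc_lift_ineq.
    + apply/seteqP; split=> v /=; first by case=> *; split.
      by case=> _ vE H; split=> //; apply: (H ord0).
  by rewrite setIT; apply/seteqP; split=> v; [exists ord0|case].
- rewrite setIT; apply/seteqP; split=> [u [t [t1 ux uy]]|u [v [/lift_eqP[vx vy]]]].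
    exists (row_mx u (const_mx t)); last exact: row_mxKl.
    split; last by rewrite /lift_ineq row_mxEr mxE -expr2; lra.
    by apply/lift_eqP; rewrite !row_mxEl row_mxEr mxE.
  rewrite /lift_ineq -expr2 => v1 <-; exists (v 0 (rshift 2 ord0)).
  by rewrite !mxE; split=> //; lra.
Qed.

Definition index2 (i j : nat) : 'I_2 -> nat := fun l => if l == ord0 then i else j.

Lemma mdeg_index2 i j : mdeg (index2 i j) = (i + j)%N.
Proof. by rewrite /mdeg big_ord_recl big_ord1. Qed.

Lemma index2E (alpha : 'I_2 -> nat) : index2 (alpha ord0) (alpha ord_max) = alpha.
Proof. by apply/funext => l; case: (ord2P l) => ->. Qed.

Lemma partial_index2_0 (F : 'rV[R]_2 -> R) i j :
  partial ord0 (mpartial (index2 i j) F) = mpartial (index2 i.+1 j) F.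
Proof.
have h (l : 'I_2) : (l < (ord0 : 'I_2))%N -> index2 i j l = 0%N by [].
have := mpartialS 0 F h.
rewrite (_ : incr_index (index2 i j) ord0 1 = index2 i.+1 j); last first.
  by apply/funext => l; case: (ord2P l) => ->; rewrite /incr_index /index2 /= ?addn1 ?addn0.
rewrite (_ : incr_index (index2 i j) ord0 0 = index2 i j) //.
by apply/funext => l; rewrite /incr_index muln0 addn0.
Qed.

Lemma partial_index2_1 (F : 'rV[R]_2 -> R) j :
  partial ord_max (mpartial (index2 0 j) F) = mpartial (index2 0 j.+1) F.
Proof.
have h (l : 'I_2) : (l < (ord_max : 'I_2))%N -> index2 0 j l = 0%N.
  by case: (ord2P l) => ->.
have := mpartialS 0 F h.
rewrite (_ : incr_index (index2 0 j) ord_max 1 = index2 0 j.+1); last first.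
  by apply/funext => l; case: (ord2P l) => ->; rewrite /incr_index /index2 /= ?addn1 ?addn0.
rewrite (_ : incr_index (index2 0 j) ord_max 0 = index2 0 j) //.
by apply/funext => l; rewrite /incr_index muln0 addn0.
Qed.

Lemma vanish_on_osc_curve (U : set 'rV[R]_2) F :
  denjoy_carleman (loglog_seq R) U F -> U 0 ->
  (forall d, 0 < d -> exists x, 0 < x < d /\ F (pt x (osq x)) = 0) ->
  exists2 e : R, 0 < e & box (0 : 'rV[R]_2) e `<=` U /\
    forall y, box (0 : 'rV[R]_2) e y -> F y = 0.
Proof.
move=> dF U0 zF; apply: (dc_vanish_near (@quasi_bound_loglog R) dF U0) => alpha.
have [sF] := dF; move=> /(_ 0 U0)[W [W0 WU [C [r [C0 r0 FW]]]]].
have /nbhs_boxP[d d0 dW] := W0.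
pose D i j x y := mpartial (index2 i j) F (pt x y).
have inW x y : `|x| < d -> `|y| < d -> W (pt x y).
  by move=> xd yd; apply: dW; apply/box_pt.
have diff i j x y k : `|x| < d -> `|y| < d ->
    derivable (mpartial (index2 i j) F) (pt x y) (delta_mx 0 k).
  move=> xd yd; apply: (@smooth_derivable R 2 U (mpartial (index2 i j) F) (pt x y) k).
    exact: smooth_mpartial.
  by apply: WU; apply: inW.
have z0 : `|0 : R| < d by rewrite normr0.
rewrite -(index2E alpha) -pt0.
(* The radius is raised to at least 1, so that its powers increase with the order. *)
apply: (@jets_vanish R D d C (Num.max 1 r)) => //.
- exact: ltW.
- by rewrite le_max lexx.
- move=> i j x xd; rewrite /D -partial_index2_0.
  have := diff i j x 0 ord0 xd z0; rewrite -{1}(upd_pt0 x 0 x) => h.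
  have := is_derive_upd h; rewrite upd_pt0.
  by rewrite (_ : (fun s => _) = (fun x => mpartial (index2 i j) F (pt x 0))) //;
    apply/funext => s; rewrite upd_pt0.
- move=> j x y xd yd; rewrite /D -partial_index2_1.
  have := diff 0%N j x y ord_max xd yd; rewrite -{1}(upd_pt1 x y y) => h.
  have := is_derive_upd h; rewrite upd_pt1.
  by rewrite (_ : (fun s => _) = (fun y => mpartial (index2 0 j) F (pt x y))) //;
    apply/funext => s; rewrite upd_pt1.
- move=> i j x y xd yd; rewrite /D; have := FW (index2 i j) _ (inW x y xd yd).
  rewrite mdeg_index2 => h; apply: le_trans h _.
  apply: ler_wpM2r; first exact: ltW (loglog_seq_gt0 _ _).
  apply: ler_wpM2r => //; apply: ler_wpM2l; first exact: ltW.
  by rewrite lerXn2r ?nnegrE ?(ltW r0) ?le_max ?lexx ?ler01 ?orbT.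
- move=> e e0; have [x [xe Fx]] := zF e e0; exists x; split=> //.
  rewrite /D mpartial0 // => l; by rewrite /index2; case: ifP.
Qed.

Lemma not_semianalytic_osc_curve : ~ semianalytic (loglog_seq R) osc_curve.
Proof.
move=> /(_ 0)[U [Uo U0 [n [B [Bb AU]]]]].
have /nbhs_boxP[e e0 eU] : nbhs (0 : 'rV[R]_2) U by exact: open_nbhs_nbhs.
have small (eps : R) : 0 < eps -> exists2 d, 0 < d &
    forall x, 0 < x < d -> box (0 : 'rV[R]_2) eps (pt x (osq x)).
  move=> eps0; have [d d0 H] := isO1_small eps0 (osq_isO R).
  by exists d => // x xd; apply/box_pt; have [] := H x xd.
have [d d0 dU] := small e e0.
(* Pigeonhole: finitely many pieces cover the curve near 0, so one of them meets it at arbitrarily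
   small x. *)
have [j Hj] : exists j, forall d, 0 < d -> exists x, 0 < x < d /\ B j (pt x (osq x)).
  apply: contrapT => /forallNP nB.
  have /choice[f Hf] : forall j, exists c : R,
      0 < c /\ forall x, 0 < x < c -> ~ B j (pt x (osq x)).
    move=> j; have /existsNP[c /not_implyP[c0 nc]] := nB j.
    exists c; split=> // x xc Bx; apply: nc; by exists x.
  pose c := \big[Order.min/Num.min d 1]_j f j.
  have c0 : 0 < c.
    rewrite /c; elim/big_ind: _ => [|a b a0 b0|j _].
    - by rewrite lt_min d0 ltr01.
    - by rewrite lt_min a0.
    - by case: (Hf j).
  have c1 : c <= Num.min d 1 by exact: bigmin_le_id.
  have cf j : c <= f j by apply: ge_bigmin_seq; rewrite ?mem_index_enum.
  have [x xc] : exists x, 0 < x < c by exists (c / 2); lra.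
  case/andP: xc => x0 xc.
  have := lt_le_trans xc c1; rewrite lt_min => /andP[xd x1].
  have : (osc_curve `&` U) (pt x (osq x)).
    by split; [apply: osc_curve_pt; rewrite x0|apply/eU/dU; rewrite x0].
  rewrite AU => -[j _ Bj]; have [_ /(_ x)] := Hf j; apply=> //.
  by rewrite x0 (lt_le_trans xc).
have [F [k [g [dF dg BE]]]] := Bb j.
have [|eps eps0 [epsU Feps]] := @vanish_on_osc_curve U F dF U0.
  by move=> c c0; have [x [xc]] := Hj c c0; rewrite BE => -[_ Fx _]; exists x.
have [c c0 Hc] := small eps eps0.
have [x [xc]] := Hj c c0; rewrite BE => -[Ux Fx gx].
(* Near 0 the equation F = 0 of this piece holds everywhere, so its strict inequalities alone cut
   out a neighbourhood of the chosen point inside the curve. *)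
apply: (@osc_curve_interior (pt x (osq x))
  [set z | box (0 : 'rV[R]_2) eps z /\ forall l, 0 < g l z]).
  apply: filterI.
    by apply: open_nbhs_nbhs; split; [exact: box_open|exact: Hc].
  apply: (@filter_forall _ 'I_k (fun l z => 0 < g l z) _ (nbhs_filter _)) => l.
  have cg := smooth_continuous (dg l).1 Ux.
  exact: (@cvgr_gt _ _ _ (nbhs_filter _) _ _ cg _ (gx l)).
move=> z [zb gz].
have : (\bigcup_j B j) z.
  by exists j => //; rewrite BE; split=> //; [exact: epsU|exact: Feps].
by rewrite -AU => -[].
Qed.

End Curve.

Theorem mainTheorem2 (R : realType) :
  (exists A : set 'rV[R]_2,
     [/\ subanalytic (loglog_seq R) A, dim_le A 1 &
         ~ semianalytic (loglog_seq R) A]) /\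
  (quasianalytic (loglog_seq R) /\ ~ lojasiewicz_property (loglog_seq R)).
Proof.
have sub := @subanalytic_osc_curve R.
have dim := @dim_osc_curve R.
have nsemi := @not_semianalytic_osc_curve R.
split; first by exists (@osc_curve R).
split; first exact: loglog_quasianalytic.
by move=> loj; apply: nsemi; apply: loj.
Qed.
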